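(* Let $k\in\mathbb{N}$, $k\ge 1$, let $p,q_1,\dots,q_k\in[1,\infty]$, let $X_1,\dots,X_k$ be any Banach spaces, and for each $j\in\{1,\dots,k\}$ let $(\Omega_j,\mu_j)$ be either any nonatomic separable measure space, with finite or infinite measure, or $\Omega_j=\mathbb{N}$ with $\mu_j$ the counting measure. Then the space $$Y=L_p^k\big(L_{q_1}(\Omega_1,\mu_1,X_1),L_{q_2}(\Omega_2,\mu_2,X_2),\dots,L_{q_k}(\Omega_k,\mu_k,X_k)\big)$$ has the Lebesgue-Bochner discretization property with a function $f$ satisfying $f(C)\le k^{2-1/p}\,C$ for all $C\ge1$ (with the convention $1/\infty=0$).
   Context: For $p\in[1,\infty]$, $k\in\mathbb N$ and Banach spaces $E_1,\dots,E_k$, $L_p^k(E_1,\dots,E_k)$ denotes the Banach space of all $k$-tuples $(a_1,\dots,a_k)$ with $a_j\in E_j$, endowed with the norm $$\|(a_1,\dots,a_k)\|=\Big(\frac1k\sum_{i=1}^k\|a_i\|_{E_i}^p\Big)^{1/p}\ \text{ if } p<\infty,\qquad \|(a_1,\dots,a_k)\|=\max_{1\le i\le k}\|a_i\|_{E_i}\ \text{ if } p=\infty.$$ $L_q(\Omega,\mu,X)$ is the Lebesgue-Bochner space of $X$-valued functions on $(\Omega,\mu)$; for a probability measure $\mu$ and a Banach space $Z$ we also write $L_p(\mu,Z)$. For $K\ge1$, a finite-dimensional normed space $W$ is called $K$-embeddable into a Banach space $Y$ if the infimum of the distortions $\|S\|\,\|S^{-1}|_{S(W)}\|$ over all injective linear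 maps $S:W\to Y$ is at most $K$ (the zero space is $K$-embeddable into every $Y$). A Banach space $Y$ has the Lebesgue-Bochner discretization property if for any separable probability measure $\mu$ there exists a function $f:[1,\infty)\to[1,\infty)$ such that for any $C\ge1$ and any finite-dimensional subspace $Z\subset Y$, if $W$ is any finite-dimensional subspace of $L_\infty(\mu,Z)$ such that $\|w\|_{L_\infty(\mu,Z)}\le C\|w\|_{L_1(\mu,Z)}$ for all $w\in W$, then $W$ (with the $L_\infty(\mu,Z)$ norm) is $f(C)$-embeddable into $Y$. The property holds ''with a function $f$ satisfying $f(C)\le h(C)$'' if, for every separable probability measure $\mu$, such an $f$ can be chosen with $f(C)\le h(C)$ for all $C\ge1$. *)

(* Defs.v *)
From HB Require Import structures.
From mathcomp Require Import all_boot all_order all_algebra.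
From mathcomp Require Import generic_quotient ring_quotient.
From mathcomp Require Import all_classical all_reals all_analysis.
From mathcomp Require Import measurable_realfun ess_sup_inf ring lra.

Set Implicit Arguments.
Unset Strict Implicit.
Unset Printing Implicit Defensive.

Import Order.TTheory GRing.Theory Num.Def Num.Theory.
Import numFieldNormedType.Exports.

Local Open Scope classical_set_scope.
Local Open Scope ring_scope.
Local Open Scope quotient_scope.

Section NormedSubspace.
Context (R : realType) (V : normedModType R) (S : submodClosed V).

Record subspace_type :=
  SubspaceElt { subspace_val :> V; subspace_valP : subspace_val \in S }.

HB.instance Definition _ := [isSub for subspace_val].
HB.instance Definition _ := [Choice of subspace_type by <:].
HB.instance Definition _ := [SubChoice_isSubLmodule of subspace_type by <:].

Let nrm (x : subspace_type) : R := `|val x|.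

Let nrmD x y : nrm (x + y) <= nrm x + nrm y.
Proof. by rewrite /nrm raddfD; exact: ler_normD. Qed.

Let nrmZ (l : R) x : nrm (l *: x) = `|l| * nrm x.
Proof. by rewrite /nrm linearZ normrZ. Qed.

Let nrm0 x : nrm x = 0 -> x = 0.
Proof. by move=> /normr0_eq0 x0; apply/val_inj; rewrite x0 raddf0. Qed.

HB.instance Definition _ :=
  Lmodule_isNormed.Build R subspace_type nrmD nrmZ nrm0.

Lemma subspace_normE (x : subspace_type) : `|x| = `|val x|.
Proof. by []. Qed.

End NormedSubspace.

Definition finite_dim (R : realType) (V : lmodType R) : Prop :=
  exists (n : nat) (b : 'I_n -> V),
    forall v, exists c : 'I_n -> R, v = \sum_(i < n) c i *: b i.

Section Bochner.
Context d (T : measurableType d) (R : realType).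
Variable mu : {measure set T -> \bar R}.

Section StronglyMeasurable.
Variable X : normedModType R.
Implicit Types f g : T -> X.

Definition simple_fun f : Prop :=
  finite_set (range f) /\ forall x, measurable (f @^-1` [set x]).

(* Pointwise limits everywhere; every almost everywhere limit of simple
   functions is almost everywhere equal to such a function, so the quotient
   below is unaffected. *)
Definition strongly_measurable f : Prop :=
  exists s : nat -> T -> X,
    (forall n, simple_fun (s n)) /\ forall t, s n t @[n --> \oo] --> f t.

Definition bochner_norm (q : \bar R) f : \bar R :=
  'N[mu]_q[EFin \o (fun t => `|f t|)].

Lemma simple_fun_preimage f (A : set X) :
  simple_fun f -> measurable (f @^-1` A).
Proof.
move=> [ff mf].
have -> : f @^-1` A = \bigcup_(x in range f `&` A) (f @^-1` [set x]).
  apply/seteqP; split=> t /=.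
    by move=> Aft; exists (f t) => //; split => //; exists t.
  by move=> [x [_ Ax]] /= ->.
by apply: fin_bigcup_measurable => //; exact: finite_setIl.
Qed.

Lemma simple_fun_cst (x : X) : simple_fun (cst x).
Proof.
split; first exact: finite_image_cst.
by move=> y; rewrite preimage_cst; case: ifPn.
Qed.

Lemma simple_fun_comp2 (F : X -> X -> X) f g :
  simple_fun f -> simple_fun g -> simple_fun (fun t => F (f t) (g t)).
Proof.
move=> sf sg; split.
  apply: (@sub_finite_set _ _ ((fun xy => F xy.1 xy.2) @` (range f `*` range g))).
    by move=> _ [t _ <-]; exists (f t, g t) => //=; split; exists t.
  by apply: finite_image; apply: finite_setX; [case: sf|case: sg].
move=> z.
have -> : (fun t => F (f t) (g t)) @^-1` [set z] =
    \bigcup_(x in range f) (f @^-1` [set x] `&` g @^-1` [set y | F x y = z]).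
  apply/seteqP; split=> t /=.
    by move=> zE; exists (f t) => //; exists t.
  by move=> [x _ [/= ->]].
apply: fin_bigcup_measurable; first by case: sf.
move=> x _; apply: measurableI; first by case: sf => _; exact.
exact: simple_fun_preimage.
Qed.

Lemma strongly_measurable_norm f :
  strongly_measurable f -> measurable_fun setT (fun t => `|f t|).
Proof.
move=> [s [ss sf]].
apply: (@measurable_fun_cvg _ _ _ _ (fun n t => `|s n t|)).
  move=> n _ A mA; rewrite setTI.
  exact: (@simple_fun_preimage (s n) (normr @^-1` A)).
by move=> t _; apply: cvg_norm; exact: sf.
Qed.

Lemma bochner_norm_cst0 q : (1 <= q)%E -> bochner_norm q 0 = 0%E.
Proof.
move=> q1; rewrite /bochner_norm (@eq_Lnorm _ _ _ _ _ _ (cst 0%E)).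
  by rewrite Lnorm0// gt_eqF// (lt_le_trans _ q1).
by move=> t /=; rewrite normr0.
Qed.

Lemma measurable_norm_poweR (r : R) (w : T -> R) : measurable_fun setT w ->
  measurable_fun setT (fun x => `|(EFin \o w) x| `^ r)%E.
Proof.
move=> mw; apply: (@measurableT_comp _ _ _ _ _ _ (fun x => x `^ r)%E) => //.
  exact: measurable_poweR.
by apply: measurableT_comp => //; exact/measurable_EFinP.
Qed.

Lemma le_Lnorm q (u v : T -> R) : (1 <= q)%E ->
  measurable_fun setT u -> measurable_fun setT v ->
  (forall t, 0 <= u t <= v t) ->
  ('N[mu]_q[EFin \o u] <= 'N[mu]_q[EFin \o v])%E.
Proof.
move=> q1 mu_ mv uv; rewrite unlock /Lnorm; case: q q1 => [r|_|//].
  rewrite lee_fin => r1.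
  have r0 : 0 < r by exact: (lt_le_trans ltr01 r1).
  apply: gt0_ler_poweR.
  - by rewrite invr_ge0 ltW.
  - by rewrite in_itv/= leey integral_ge0// => x _; exact: poweR_ge0.
  - by rewrite in_itv/= leey integral_ge0// => x _; exact: poweR_ge0.
  apply: ge0_le_integral => //.
  - by move=> x _; exact: poweR_ge0.
  - exact: measurable_norm_poweR.
  - exact: measurable_norm_poweR.
  move=> x _; have /andP[u0 uvx] := uv x.
  apply: gt0_ler_poweR; rewrite ?in_itv/= ?leey ?lee_fin ?normr_ge0//.
    exact: ltW.
  by rewrite !ger0_norm// (le_trans u0).
case: ifPn => // _; apply: le_ess_sup; apply/nearW => x /=.
have /andP[u0 uvx] := uv x.
by rewrite lee_fin !ger0_norm// (le_trans u0).
Qed.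

Lemma bochner_normD q f g : (1 <= q)%E ->
  strongly_measurable f -> strongly_measurable g ->
  (bochner_norm q (f + g)%R <= bochner_norm q f + bochner_norm q g)%E.
Proof.
move=> q1 mf mg; have mnf := strongly_measurable_norm mf.
have mng := strongly_measurable_norm mg.
apply: le_trans (eminkowski mu mnf mng q1).
apply: le_Lnorm => //.
- apply: strongly_measurable_norm.
  case: mf mg => [s [ss sf]] [s' [ss' sf']].
  exists (fun n t => s n t + s' n t); split.
    by move=> n; exact: (simple_fun_comp2 +%R).
  by move=> t; exact: cvgD.
- exact: measurable_funD.
by move=> t; rewrite normr_ge0 /= ler_normD.
Qed.

Lemma bochner_normZ q f (a : R) : (1 <= q)%E ->
  strongly_measurable f -> (bochner_norm q f < +oo)%E ->
  bochner_norm q (a *: f) = (`|a|%:E * bochner_norm q f)%E.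
Proof.
move=> q1 mf fq; have mnf := strongly_measurable_norm mf.
have Lf : (fun t => `|f t|) \in Lfun mu q.
  by apply/andP; split; rewrite inE.
have := LnormZ (Lfun_Sub q1 Lf) `|a|; rewrite normr_id => <-.
by apply: eq_Lnorm => t /=; rewrite normrZ.
Qed.

Lemma strongly_measurableZD f g (a : R) :
  strongly_measurable f -> strongly_measurable g ->
  strongly_measurable (a *: f + g).
Proof.
move=> [s [ss sf]] [s' [ss' sf']].
exists (fun n t => a *: s n t + s' n t); split.
  by move=> n; exact: (simple_fun_comp2 (fun x y => a *: x + y)).
by move=> t; apply: cvgD => //; exact: cvgZr.
Qed.

Lemma eq_bochner_norm q f g : (1 <= q)%E ->
  strongly_measurable f -> strongly_measurable g ->
  {ae mu, forall t, f t = g t} -> bochner_norm q f = bochner_norm q g.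
Proof.
move=> q1 mf mg fg; rewrite /bochner_norm unlock /Lnorm.
case: q q1 => [r r1|_|//]; last first.
  by case: ifPn => // _; apply: eq_ess_sup; apply: filterS fg => t /= ->.
congr (_ `^ _)%E; apply: ae_eq_integral => //.
- exact/measurable_norm_poweR/strongly_measurable_norm.
- exact/measurable_norm_poweR/strongly_measurable_norm.
by apply: filterS fg => t /= ->.
Qed.

End StronglyMeasurable.

Section BochnerSpace.
Variables (q : \bar R) (q1 : (1 <= q)%E) (X : normedModType R).

Definition bochner_pred (_ : (1 <= q)%E) : {pred T -> X} :=
  mem [set f | strongly_measurable f /\ (bochner_norm q f < +oo)%E].

Lemma bochner_pred_submod : submod_closed (bochner_pred q1).
Proof.
split.
  rewrite inE; split; last by rewrite bochner_norm_cst0.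
  exists (fun=> cst 0); split=> [n|t]; first exact: simple_fun_cst.
  exact: cvg_cst.
move=> a f g /[!inE] -[mf fq] [mg gq]; split.
  exact: strongly_measurableZD.
have maf : strongly_measurable (a *: f).
  rewrite -[_ *: _]addr0; apply: strongly_measurableZD => //.
  exists (fun=> cst 0); split=> [n|t]; first exact: simple_fun_cst.
  exact: cvg_cst.
rewrite (le_lt_trans (bochner_normD _ _ _))// bochner_normZ//.
by rewrite lte_add_pinfty// lte_mul_pinfty.
Qed.

HB.instance Definition _ :=
  GRing.isSubmodClosed.Build R _ (bochner_pred q1) bochner_pred_submod.

Record bochner_fun := BochnerFun {
  bochner_val :> T -> X ; bochner_valP : bochner_val \in bochner_pred q1 }.

HB.instance Definition _ := [isSub for bochner_val].
HB.instance Definition _ := [Choice of bochner_fun by <:].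
HB.instance Definition _ := [SubChoice_isSubLmodule of bochner_fun by <:].

Lemma bochner_fun_strongly_measurable (f : bochner_fun) : strongly_measurable f.
Proof. by have := bochner_valP f; rewrite inE => -[]. Qed.

Lemma bochner_fun_finite_norm (f : bochner_fun) : (bochner_norm q f < +oo)%E.
Proof. by have := bochner_valP f; rewrite inE => -[]. Qed.

Definition bochner_null : {pred bochner_fun} :=
  mem [set f : bochner_fun | {ae mu, forall t, f t = 0}].

Lemma bochner_null_submod : submod_closed bochner_null.
Proof.
split; first by rewrite inE; exact: aeW.
move=> a f g /[!inE] /= f0 g0.
apply: filterS2 f0 g0 => t f0 g0.
by change (a *: f t + g t = 0); rewrite f0 g0 scaler0 addr0.
Qed.

HB.instance Definition _ :=
  GRing.isSubmodClosed.Build R _ bochner_null bochner_null_submod.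

Definition bochner_space : Type := Quotient.quot bochner_null.

HB.instance Definition _ := GRing.Zmodule.on bochner_space.

Definition bochner_class (f : bochner_fun) : bochner_space :=
  \pi_(Quotient.quot bochner_null) f.

Definition bochner_repr (u : bochner_space) : bochner_fun := repr u.

Lemma bochner_reprK : cancel bochner_repr bochner_class.
Proof. by move=> u; exact: reprK. Qed.

Lemma bochner_classP (f g : bochner_fun) :
  bochner_class f = bochner_class g <-> {ae mu, forall t, f t = g t}.
Proof.
have fgE : (bochner_class f == bochner_class g) = (f - g \in bochner_null).
  by rewrite Quotient.idealrBE.
split=> [/eqP|fg]; last apply/eqP; rewrite fgE inE /=.
  apply: filterS => t; change (f t - g t = 0 -> f t = g t).
  by move/eqP; rewrite subr_eq0 => /eqP.
apply: filterS fg => t; change (f t = g t -> f t - g t = 0).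
by move=> ->; rewrite subrr.
Qed.

Lemma bochner_classD f g :
  bochner_class (f + g) = bochner_class f + bochner_class g.
Proof. exact: raddfD. Qed.

Definition bochner_scale (a : R) (u : bochner_space) : bochner_space :=
  bochner_class (a *: bochner_repr u).

Lemma bochner_classZ a f :
  bochner_class (a *: f) = bochner_scale a (bochner_class f).
Proof.
apply/bochner_classP.
have /bochner_classP := esym (bochner_reprK (bochner_class f)).
set g := bochner_repr _; apply: filterS => t.
by change (f t = g t -> a *: f t = a *: g t) => ->.
Qed.

Let scaleA a b u : bochner_scale a (bochner_scale b u) = bochner_scale (a * b) u.
Proof. by rewrite -[u]bochner_reprK -!bochner_classZ scalerA. Qed.

Let scale1 : left_id 1 bochner_scale.
Proof. by move=> u; rewrite -[u]bochner_reprK -bochner_classZ scale1r. Qed.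

Let scaleDr : right_distributive bochner_scale +%R.
Proof.
move=> a u v; rewrite -[u]bochner_reprK -[v]bochner_reprK.
by rewrite -bochner_classD -!bochner_classZ scalerDr bochner_classD.
Qed.

Let scaleDl u : {morph bochner_scale^~ u : a b / a + b}.
Proof.
move=> a b; rewrite -[u]bochner_reprK -!bochner_classZ.
by rewrite scalerDl bochner_classD.
Qed.

HB.instance Definition _ := GRing.Zmodule_isLmodule.Build R bochner_space
  scaleA scale1 scaleDr scaleDl.

Lemma bochner_scaleE a f :
  a *: bochner_class f = bochner_class (a *: f).
Proof. by rewrite bochner_classZ. Qed.

Let nrm (u : bochner_space) : R := fine (bochner_norm q (bochner_repr u)).

Let nrmE (f : bochner_fun) : (nrm (bochner_class f))%:E = bochner_norm q f.
Proof.
rewrite /nrm fineK.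
  apply: eq_bochner_norm => //; try exact: bochner_fun_strongly_measurable.
  exact/bochner_classP/bochner_reprK.
rewrite ge0_fin_numE; first exact: bochner_fun_finite_norm.
exact: Lnorm_ge0.
Qed.

Let nrmD u v : nrm (u + v) <= nrm u + nrm v.
Proof.
rewrite -[u]bochner_reprK -[v]bochner_reprK -bochner_classD -lee_fin EFinD.
rewrite !nrmE; apply: bochner_normD => //;
  exact: bochner_fun_strongly_measurable.
Qed.

Let nrmZ (a : R) u : nrm (a *: u) = `|a| * nrm u.
Proof.
apply: EFin_inj; rewrite EFinM -[u]bochner_reprK bochner_scaleE !nrmE.
apply: bochner_normZ => //; first exact: bochner_fun_strongly_measurable.
exact: bochner_fun_finite_norm.
Qed.

Let nrm0 u : nrm u = 0 -> u = 0.
Proof.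
move=> u0; rewrite -[u]bochner_reprK.
have -> : (0 : bochner_space) = bochner_class 0 by rewrite [RHS]raddf0.
apply/bochner_classP.
have : bochner_norm q (bochner_repr u) = 0%E.
  by rewrite -nrmE bochner_reprK u0.
move/Lnorm_eq0_eq0 => H.
have : (EFin \o (fun t => `|bochner_repr u t|)) = \0%E %[ae mu].
  apply: H; last exact: lt_le_trans q1.
  exact/measurable_EFinP/strongly_measurable_norm/bochner_fun_strongly_measurable.
apply: filterS => t /(_ I) /= [] /eqP.
by rewrite normr_eq0 => /eqP.
Qed.

HB.instance Definition _ :=
  Lmodule_isNormed.Build R bochner_space nrmD nrmZ nrm0.

Lemma bochner_space_normE (f : bochner_fun) :
  `|bochner_class f|%:E = bochner_norm q f.
Proof. exact: nrmE. Qed.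

End BochnerSpace.
End Bochner.

Section LpkSpace.
Context (R : realType) (k : nat) (p : \bar R) (p1 : (1 <= p)%E).
Variable E : 'I_k -> normedModType R.

Definition Lpk_space (_ : (1 <= p)%E) : Type := forall j : 'I_k, E j.

Local Notation L := (Lpk_space p1).

HB.instance Definition _ := gen_eqMixin L.
HB.instance Definition _ := gen_choiceMixin L.

(* The second case is p = +oo, as 1 <= p excludes -oo. *)
Definition Lpk_norm (a : forall j, E j) : R :=
  match p with
  | r%:E => (k%:R^-1 * \sum_(i < k) `|a i| `^ r) `^ r^-1
  | _ => \big[Num.max/0]_(i < k) `|a i|
  end.

Let zero : L := fun j => 0.
Let opp (a : L) : L := fun j => - a j.
Let add (a b : L) : L := fun j => a j + b j.
Let scale (c : R) (a : L) : L := fun j => c *: a j.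

Let ext (a b : L) : (forall j, a j = b j) -> a = b.
Proof. exact: functional_extensionality_dep. Qed.

Let addA : associative add.
Proof. by move=> a b c; apply: ext => j; rewrite /add addrA. Qed.
Let addC : commutative add.
Proof. by move=> a b; apply: ext => j; rewrite /add addrC. Qed.
Let add0 : left_id zero add.
Proof. by move=> a; apply: ext => j; rewrite /add add0r. Qed.
Let addN : left_inverse zero opp add.
Proof. by move=> a; apply: ext => j; rewrite /add addNr. Qed.

HB.instance Definition _ := GRing.isZmodule.Build L addA addC add0 addN.

Let scaleA b c a : scale b (scale c a) = scale (b * c) a.
Proof. by apply: ext => j; rewrite /scale scalerA. Qed.
Let scale1 : left_id 1 scale.
Proof. by move=> a; apply: ext => j; rewrite /scale scale1r. Qed.
Let scaleDr : right_distributive scale +%R.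
Proof. by move=> c a b; apply: ext => j; rewrite /scale scalerDr. Qed.
Let scaleDl a : {morph scale^~ a : b c / b + c}.
Proof. by move=> b c; apply: ext => j; rewrite /scale scalerDl. Qed.

HB.instance Definition _ := GRing.Zmodule_isLmodule.Build R L
  scaleA scale1 scaleDr scaleDl.

Let nrm (a : L) : R := Lpk_norm a.

Let nrmZ (c : R) (a : L) : nrm (c *: a) = `|c| * nrm a.
Proof.
rewrite /nrm /Lpk_norm; case: p p1 => [r r1|_|//].
  have r0 : 0 < r by exact: (lt_le_trans ltr01 r1).
  under eq_bigr => i _ do rewrite [(c *: a) i]/(c *: a i) normrZ powRM//.
  rewrite -mulr_sumr mulrCA powRM ?powR_ge0//.
    by rewrite -powRrM mulfV ?gt_eqF// powRr1.
  by rewrite mulr_ge0 ?invr_ge0// sumr_ge0// => i _; exact: powR_ge0.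
apply: (big_rec2 (fun x y => x = `|c| * y)); first by rewrite mulr0.
move=> i x y _ ->; rewrite [(c *: a) i]/(c *: a i) normrZ.
by rewrite maxr_pMr.
Qed.

Let nrm_ge0 a : 0 <= nrm a.
Proof.
rewrite /nrm /Lpk_norm; case: p => [r||]; first exact: powR_ge0;
  by apply: (big_ind (fun x => 0 <= x)) => // x y; rewrite le_max => ->.
Qed.

Let nrm0 a : nrm a = 0 -> a = 0.
Proof.
move=> a0; apply: ext => j; apply/eqP; rewrite -normr_eq0 [X in _ == X]/=.
have k0 : (0 < k)%N by case: k j {a0} => [[]|].
move: a0; rewrite /nrm /Lpk_norm; case: p p1 => [r r1|_|//].
  have r0 : 0 < r by exact: (lt_le_trans ltr01 r1).
  move/powR_eq0_eq0/eqP.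
  rewrite mulf_eq0 invr_eq0 pnatr_eq0 gtn_eqF//= psumr_eq0; last first.
    by move=> i _; exact: powR_ge0.
  by move=> /allP/(_ j)/(_ (mem_index_enum _))/eqP/powR_eq0_eq0/eqP.
move=> a0; rewrite eq_le normr_ge0 andbT -a0.
exact: (le_bigmax _ (fun i => `|a i|)).
Qed.

Lemma minkowski_sum (r c : R) (u v : 'I_k -> R) : 1 <= r -> 0 <= c ->
  (forall i, 0 <= u i) -> (forall i, 0 <= v i) ->
  (c * \sum_(i < k) (u i + v i) `^ r) `^ r^-1 <=
  (c * \sum_(i < k) u i `^ r) `^ r^-1 + (c * \sum_(i < k) v i `^ r) `^ r^-1.
Proof.
move=> r1 c0 u0 v0; have r0 : 0 < r by exact: (lt_le_trans ltr01 r1).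
have cS0 (w : 'I_k -> R) : 0 <= c * \sum_(i < k) w i `^ r.
  by rewrite mulr_ge0// sumr_ge0// => i _; exact: powR_ge0.
have normalize (w : 'I_k -> R) (M : R) : (forall i, 0 <= w i) -> 0 < M ->
    (c * \sum_(i < k) w i `^ r) `^ r^-1 <= M ->
    c * \sum_(i < k) (w i / M) `^ r <= 1.
  move=> w0 M0 wM.
  have M0' := ltW M0.
  under eq_bigr => i _ do rewrite powRM ?invr_ge0//.
  rewrite -mulr_suml mulrA.
  have -> : M^-1 `^ r = (M `^ r)^-1.
    by rewrite -[RHS]powR_inv1 ?powR_ge0// powRAC powR_inv1.
  rewrite ler_pdivrMr ?powR_gt0// mul1r.
  have -> : c * \sum_(i < k) w i `^ r =
      ((c * \sum_(i < k) w i `^ r) `^ r^-1) `^ r.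
    by rewrite -powRrM mulVf ?gt_eqF// powRr1.
  by rewrite ge0_ler_powR ?nnegrE ?powR_ge0 ?(ltW r0).
have key (M M' : R) : 0 < M -> 0 < M' ->
    (c * \sum_(i < k) u i `^ r) `^ r^-1 <= M ->
    (c * \sum_(i < k) v i `^ r) `^ r^-1 <= M' ->
    (c * \sum_(i < k) (u i + v i) `^ r) `^ r^-1 <= M + M'; last first.
  apply/ler_addgt0Pr => e e0; have e20 : 0 < e / 2 by rewrite divr_gt0.
  rewrite [e]splitr addrACA; apply: key.
  - by rewrite ltr_wpDl ?powR_ge0.
  - by rewrite ltr_wpDl ?powR_ge0.
  - by rewrite lerDl ltW.
  - by rewrite lerDl ltW.
move=> M0 M'0 uM vM.
have S0 : 0 < M + M' by rewrite addr_gt0.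
have {}uM := normalize u M u0 M0 uM.
have {}vM := normalize v M' v0 M'0 vM.
have [M0' M'0' S0'] : [/\ 0 <= M, 0 <= M' & 0 <= M + M'] by rewrite !ltW.
have MN0 : M != 0 by rewrite gt_eqF.
have M'N0 : M' != 0 by rewrite gt_eqF.
have SN0 : M + M' != 0 by rewrite gt_eqF.
pose t := M / (M + M').
have t0 : 0 <= t by rewrite divr_ge0.
have t1 : t <= 1 by rewrite ler_pdivrMr// mul1r lerDl.
have tE : 1 - t = M' / (M + M') by rewrite /t; field.
have cvx i : ((u i + v i) / (M + M')) `^ r <=
    t * (u i / M) `^ r + (1 - t) * (v i / M') `^ r.
  have -> : (u i + v i) / (M + M') = t * (u i / M) + (1 - t) * (v i / M').
    by rewrite tE /t; field; rewrite MN0 M'N0 SN0.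
  apply: (convex_powR r1 (Itv01 t0 t1)).
  - by rewrite inE /= in_itv /= andbT divr_ge0.
  - by rewrite inE /= in_itv /= andbT divr_ge0.
have sumle : c * \sum_(i < k) ((u i + v i) / (M + M')) `^ r <= 1.
  apply: (@le_trans _ _ (c * \sum_(i < k)
    (t * (u i / M) `^ r + (1 - t) * (v i / M') `^ r))).
    by rewrite ler_wpM2l// ler_sum.
  rewrite big_split/= -!mulr_sumr mulrDr !(mulrCA c).
  apply: (@le_trans _ _ (t * 1 + (1 - t) * 1)); last by rewrite !mulr1 subrKC.
  by apply: lerD; apply: ler_wpM2l => //; rewrite subr_ge0.
have -> : (M + M') = ((M + M') `^ r) `^ r^-1.
  by rewrite -powRrM mulfV ?gt_eqF// powRr1.
have Sr0 : 0 < (M + M') `^ r by rewrite powR_gt0.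
have Suv : c * \sum_(i < k) (u i + v i) `^ r <= (M + M') `^ r.
  rewrite -[leRHS]mul1r -ler_pdivrMr//; apply: le_trans sumle.
  rewrite -mulrA ler_wpM2l// mulr_suml ler_sum// => i _.
  have -> : ((M + M') `^ r)^-1 = (M + M')^-1 `^ r.
    by rewrite -[LHS]powR_inv1 ?powR_ge0// powRAC powR_inv1.
  by rewrite powRM ?addr_ge0 ?invr_ge0.
by rewrite ge0_ler_powR ?invr_ge0 ?nnegrE ?(ltW r0) ?(ltW Sr0).
Qed.

Let nrmD a b : nrm (a + b) <= nrm a + nrm b.
Proof.
rewrite /nrm /Lpk_norm; case: p p1 => [r r1|_|//]; last first.
  apply/bigmax_leP; split.
    by apply: addr_ge0; apply: (big_ind (fun x => 0 <= x)) => // x y;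
      rewrite le_max => ->.
  move=> i _; rewrite (le_trans (ler_normD _ _))// lerD//.
    exact: (le_bigmax _ (fun i => `|a i|)).
  exact: (le_bigmax _ (fun i => `|b i|)).
have r0 : 0 < r by exact: (lt_le_trans ltr01 r1).
apply: le_trans (minkowski_sum r1 _ _ _); rewrite ?invr_ge0//.
rewrite ge0_ler_powR ?invr_ge0 ?(ltW r0) ?nnegrE//.
- by rewrite mulr_ge0 ?invr_ge0// sumr_ge0// => i _; exact: powR_ge0.
- by rewrite mulr_ge0 ?invr_ge0// sumr_ge0// => i _; exact: powR_ge0.
rewrite ler_wpM2l ?invr_ge0// ler_sum// => i _.
by rewrite ge0_ler_powR ?(ltW r0) ?nnegrE ?addr_ge0// ler_normD.
Qed.

HB.instance Definition _ := Lmodule_isNormed.Build R L nrmD nrmZ nrm0.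

Lemma Lpk_space_normE (a : L) : `|a| = Lpk_norm a.
Proof. by []. Qed.

End LpkSpace.

Record measure_space (R : realType) := MeasureSpace {
  ms_display : measure_display ;
  ms_carrier :> measurableType ms_display ;
  ms_measure : {measure set ms_carrier -> \bar R} }.

Definition nat_counting_space (R : realType) : measure_space R :=
  @MeasureSpace R _ nat (@counting nat R).

Section MeasureProperties.
Context d (T : measurableType d) (R : realType).
Variable mu : {measure set T -> \bar R}.
Local Open Scope ereal_scope.

(* An atom is an A of positive measure without a measurable B `<=` A such that
   B and A `\` B both have positive measure. *)
Definition nonatomic : Prop :=
  forall A, measurable A -> 0 < mu A ->
    exists B, [/\ measurable B, B `<=` A, 0 < mu B & 0 < mu (A `\` B)].

(* The measurable sets of finite measure form a separable pseudometric space
   for the distance mu (A `+` B), the measure of the symmetric difference. *)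
Definition separable_measure : Prop :=
  exists B : nat -> set T, (forall n, measurable (B n)) /\
    forall A, measurable A -> mu A < +oo ->
      forall e : R, (0 < e)%R -> exists n, mu (A `+` B n) < e%:E.

End MeasureProperties.

Section Embeddability.
Context (R : realType) (W Y : normedModType R).
Local Open Scope ereal_scope.

Definition opnorm (S : W -> Y) : \bar R :=
  ereal_sup [set `|S x|%:E | x in [set x | (`|x| <= 1)%R]].

(* Operator norm of the inverse of an injective S on its range: the elements of
   the unit ball of the range are written S x, with preimage x. *)
Definition inv_opnorm (S : W -> Y) : \bar R :=
  ereal_sup [set `|x|%:E | x in [set x | (`|S x| <= 1)%R]].

Definition distortion (S : W -> Y) : \bar R := opnorm S * inv_opnorm S.

Definition embeddable (K : R) : Prop :=
  ereal_inf [set distortion S | S in [set S : {linear W -> Y} | injective S]]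
    <= K%:E.

End Embeddability.

Section LebesgueBochnerDiscretization.
Context (R : realType).

Definition Linfty_space d (T : measurableType d)
    (mu : {measure set T -> \bar R}) (Z : normedModType R) : normedModType R :=
  bochner_space mu (leey 1%E) Z.

(* The L_1 norm of the class w is computed on a representative; it depends on
   the class only (eq_bochner_norm). *)
Definition LB_discretizes d (T : measurableType d) (mu : probability T R)
    (Y : normedModType R) (f : R -> R) : Prop :=
  forall (C : R) (Z : submodClosed Y), 1 <= C ->
    finite_dim (subspace_type Z) ->
    forall W : submodClosed (Linfty_space mu (subspace_type Z)),
      finite_dim (subspace_type W) ->
      (forall w, w \in W ->
        (`|w|%:E <= C%:E * bochner_norm mu 1 (bochner_repr w))%E) ->
      embeddable (subspace_type W) Y (f C).

Definition LB_discretization_property (Y : normedModType R) : Prop :=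
  forall d (T : measurableType d) (mu : probability T R),
    separable_measure mu ->
    exists f : R -> R, (forall C, 1 <= C -> 1 <= f C) /\ LB_discretizes mu Y f.

Definition LB_discretization_property_le (Y : normedModType R) (h : R -> R) :
    Prop :=
  forall d (T : measurableType d) (mu : probability T R),
    separable_measure mu ->
    exists f : R -> R, [/\ forall C, 1 <= C -> 1 <= f C,
      LB_discretizes mu Y f & forall C, 1 <= C -> f C <= h C].

End LebesgueBochnerDiscretization.

(* Main.v *)
From HB Require Import structures.
Require Import Defs.
From mathcomp Require Import all_boot all_order all_algebra.
From mathcomp Require Import all_classical all_reals all_analysis.
From mathcomp Require Import measurable_realfun ess_sup_inf ring lra.

Set Implicit Arguments.
Unset Strict Implicit.
Unset Printing Implicit Defensive.

Import Order.TTheory GRing.Theory Num.Def Num.Theory.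
Import numFieldNormedType.Exports.

Local Open Scope classical_set_scope.
Local Open Scope ring_scope.

(* Sampling an essentially bounded [W] on finitely many cells of a fine
   partition of the probability space replaces [w] by vectors [z_i(w)] of [Y]
   with weights [lam_i], such that, up to small errors,
   [max_i |z_i(w)| <= |w|_oo] and [|w|_1 <= sum_i lam_i |z_i(w)|].  In each
   factor [L_q(Omega, X)] there are disjoint copies of the [z_i], the [i]-th one
   carrying the fraction [lam_i] of the mass: for a nonatomic measure cut every
   set on which the functions are almost constant in proportions [lam_i]
   (Sierpinski), for the counting measure use the arithmetic progressions
   [i + m N].  The sum [v(w)] of the copies is linear in [w], and
   [sum_i lam_i |z_i| <= |v| <= max_i |z_i|] whatever [q] is.
   With [kap = k^(1/p)], the inequalities
   [|a_j| <= kap |a|], [|a| <= max_j |a_j|], [sum_j |a_j| <= k |a|] and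
   [kap |a| <= sum_j |a_j|] then bound the distortion of [w |-> v(w)] by
   [k C (1 + o(1))], and [k <= k^(2 - 1/p)]. *)

(** * Finite-dimensional spaces *)

Section FiniteDimension.
Context (R : realType).

Definition lincomb (V : lmodType R) n (b : 'I_n -> V) (c : 'I_n -> R) : V :=
  \sum_(i < n) c i *: b i.

Definition abs_sum n (c : 'I_n -> R) : R := \sum_(i < n) `|c i|.

Lemma abs_sum_ge0 n (c : 'I_n -> R) : 0 <= abs_sum c.
Proof. exact: sumr_ge0. Qed.

(** A spanning family of least size is independent: a relation with a nonzero coefficient would
    express one vector through the others, and dropping it would leave a smaller spanning family. *)
Lemma finite_dim_basis (V : lmodType R) : finite_dim V ->
  exists (n : nat) (b : 'I_n -> V),
    (forall v, exists c, v = lincomb b c) /\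
    (forall c, lincomb b c = 0 -> forall i, c i = 0).
Proof.
pose P n := `[< exists b : 'I_n -> V, forall v, exists c, v = lincomb b c >].
move=> [n0 [b0 b0P]].
have exP : exists n, P n by exists n0; apply/asboolP; exists b0.
case: (ex_minnP exP) => n /asboolP[b bP] nmin.
exists n, b; split=> // c c0 i; apply/eqP; apply: contrapT => /negP ci0.
case: n i b bP nmin c c0 ci0 => [[]//|n] i b bP nmin c c0 ci0.
have biE : b i = \sum_(j < n) (- (c i)^-1 * c (lift i j)) *: b (lift i j).
  move: c0; rewrite /lincomb (bigD1_ord i)//= => /eqP.
  rewrite addr_eq0 => /eqP/(congr1 (fun x => (c i)^-1 *: x)).
  rewrite scalerA mulVf// scale1r => ->.
  rewrite scalerN -scaleNr scaler_sumr.
  by apply: eq_bigr => j _; rewrite scalerA.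
have : P n; last by move=> /nmin; rewrite ltnn.
apply/asboolP; exists (fun j => b (lift i j)) => v; have [d ->] := bP v.
exists (fun j => d (lift i j) + d i * (- (c i)^-1 * c (lift i j))).
rewrite /lincomb (bigD1_ord i)//= biE scaler_sumr -big_split/=.
by apply: eq_bigr => j _; rewrite scalerA scalerDl addrC.
Qed.

(** On the compact sphere [abs_sum c = 1] the continuous function [|lincomb b c|] attains its
    minimum, which is positive by independence; homogeneity does the rest. The empty family is
    separate because its sphere is empty. The bound turns errors of size [e * abs_sum c] into small
    multiples of the norm. *)
Lemma independent_abs_sum_le (V : normedModType R) n (b : 'I_n -> V) :
  (forall c, lincomb b c = 0 -> forall i, c i = 0) ->
  exists2 K, 0 < K & forall c, abs_sum c <= K * `|lincomb b c|.
Proof.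
case: n b => [|n] b bI.
  by exists 1 => // c; rewrite /abs_sum big_ord0 mul1r.
pose S := [set x : 'rV[R]_n.+1 | abs_sum (x 0) = 1].
pose f (x : 'rV[R]_n.+1) := `|lincomb b (x 0)|.
have fc : continuous f.
  have lc : continuous (fun x : 'rV[R]_n.+1 => lincomb b (x 0)).
    apply: (continuous_big (@add_continuous V)) => i _ x.
    apply: (@cvgZr_tmp _ _ _ (nbhs x)); exact: (@coord_continuous R 1 n.+1 0 i x).
  by move=> x; apply: continuous_comp (lc x) _; exact: norm_continuous.
have absc : continuous (fun x : 'rV[R]_n.+1 => abs_sum (x 0)).
  apply: (continuous_big (@add_continuous R^o)) => i _ x.
  apply: continuous_comp; first exact: (@coord_continuous R 1 n.+1 0 i x).
  exact: norm_continuous.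
have Sc : compact S.
  apply: bounded_closed_compact.
    exists 1; split=> // y y1 x /= x1; apply: ltW; apply: le_lt_trans y1.
    rewrite -x1 /normr/= mx_normrE; apply/bigmax_leP; split=> [|[i j] _ /=].
      exact: abs_sum_ge0.
    by rewrite ord1 /abs_sum (bigD1 j)//= lerDl sumr_ge0.
  apply: (@closed_comp _ _ (fun x : 'rV[R]_n.+1 => abs_sum (x 0)) [set 1]).
    by move=> x _; exact: absc.
  exact: closed_eq.
have S0 : S !=set0.
  exists (delta_mx 0 0) => /=.
  rewrite /S/= /abs_sum (bigD1 ord0)//= mxE !eqxx normr1 big1 ?addr0// => i /negPf i0.
  by rewrite mxE i0 andbF normr0.
have [x Sx xmin] := EVT_min_rV S0 Sc (continuous_subspaceT fc).
have fx0 : 0 < f x.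
  rewrite lt_neqAle normr_ge0 andbT eq_sym normr_eq0; apply/eqP => /bI x0.
  move: Sx; rewrite /S inE/= => /eqP; rewrite /abs_sum big1 ?(eq_sym 0) ?oner_eq0//.
  by move=> i _; rewrite x0 normr0.
exists (f x)^-1 => [|c]; first by rewrite invr_gt0.
have [->|c0] := eqVneq (abs_sum c) 0; first by
  rewrite mulr_ge0 ?invr_ge0 ?normr_ge0 ?ltW.
have cgt0 : 0 < abs_sum c by rewrite lt_neqAle eq_sym c0 abs_sum_ge0.
pose y : 'rV[R]_n.+1 := \row_i ((abs_sum c)^-1 * c i).
have Sy : y \in S.
  rewrite inE /S/= /abs_sum.
  under eq_bigr do rewrite mxE normrM ger0_norm ?invr_ge0 ?abs_sum_ge0//.
  by rewrite -mulr_sumr mulVf.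
have fy : f y = (abs_sum c)^-1 * `|lincomb b c|.
  rewrite /f /lincomb -[in RHS](@ger0_norm _ (abs_sum c)^-1) ?invr_ge0 ?abs_sum_ge0//.
  rewrite -normrZ scaler_sumr; congr `|_|.
  by apply: eq_bigr => i _; rewrite mxE scalerA.
have := xmin _ Sy; rewrite fy ler_pdivlMl// mulrC => h.
by rewrite ler_pdivlMl.
Qed.

Lemma lincombD (V : lmodType R) n (b : 'I_n -> V) c d :
  lincomb b (c \+ d) = lincomb b c + lincomb b d.
Proof. by rewrite -big_split; apply: eq_bigr => i _; rewrite scalerDl. Qed.

Lemma lincomb_sum (V : lmodType R) n m (x : 'I_m -> 'I_n -> V) c :
  lincomb (fun a => \sum_(i < m) x i a) c = \sum_(i < m) lincomb (x i) c.
Proof.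
rewrite /lincomb exchange_big/=; apply: eq_bigr => a _; exact: scaler_sumr.
Qed.

Lemma lincomb_scale (V : lmodType R) n (x : 'I_n -> V) b c :
  lincomb (fun a => b *: x a) c = b *: lincomb x c.
Proof.
by rewrite scaler_sumr; apply: eq_bigr => a _; rewrite !scalerA mulrC.
Qed.

Lemma lincomb_close (V : normedModType R) n (b b' : 'I_n -> V) (e : R) c :
  (forall i, `|b i - b' i| <= e) ->
  `|lincomb b c| <= `|lincomb b' c| + e * abs_sum c.
Proof.
move=> bb'; rewrite -[lincomb b c](subrK (lincomb b' c)) addrC.
apply: le_trans (ler_normD _ _) _; rewrite lerD2l /lincomb -sumrB mulr_sumr.
apply: le_trans (ler_norm_sum _ _ _) _; apply: ler_sum => i _.
by rewrite -scalerBr normrZ mulrC ler_wpM2r.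
Qed.

Lemma lincombZ (V : lmodType R) n (b : 'I_n -> V) a c :
  lincomb b (a \*o c) = a *: lincomb b c.
Proof. by rewrite scaler_sumr; apply: eq_bigr => i _; rewrite scalerA. Qed.

Lemma lincomb_inj (V : lmodType R) n (b : 'I_n -> V) c d :
  (forall c, lincomb b c = 0 -> forall i, c i = 0) ->
  lincomb b c = lincomb b d -> c = d.
Proof.
move=> bI cd; apply/funext => i; apply/eqP; rewrite -subr_eq0; apply/eqP.
have := bI (c \+ (-1 \*o d)); rewrite lincombD lincombZ cd scaleN1r subrr.
by move=> /(_ erefl i) /=; rewrite mulN1r.
Qed.

Lemma val_lincomb (V : normedModType R) (S : submodClosed V) n
    (b : 'I_n -> subspace_type S) c :
  val (lincomb b c) = lincomb (val \o b) c.
Proof.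
rewrite /lincomb linear_sum; apply: eq_bigr => a _.
by rewrite linearZ.
Qed.

Lemma embeddable_le (W Y : normedModType R) (K K' : R) :
  K <= K' -> embeddable W Y K -> embeddable W Y K'.
Proof. by move=> KK' /le_trans; apply; rewrite lee_fin. Qed.

(** The map sends [b i] to [v i]. Since [embeddable] asks only for an infimum, two-sided bounds with
    an arbitrarily small loss [eta] are enough. *)
Lemma embeddable_lincomb (W Y : normedModType R) n (b : 'I_n -> W) (L U : R) :
  (forall w, exists c, w = lincomb b c) ->
  (forall c, lincomb b c = 0 -> forall i, c i = 0) ->
  0 < L -> 0 <= U ->
  (forall eta, 0 < eta -> exists v : 'I_n -> Y, forall c,
    (L - eta) * `|lincomb b c| <= `|lincomb v c| <= (U + eta) * `|lincomb b c|) ->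
  embeddable W Y (U / L).
Proof.
move=> bS bI L0 U0 H; apply/lee_addgt0Pr => e e0.
have LU0 : 0 < L + U by rewrite ltr_wpDr.
(* The first bound keeps [L - eta] positive. Both together give [eta * (L + U) + e * L * eta <= e *
   L ^+ 2], which is [(U + eta) / (L - eta) <= U / L + e] with denominators cleared. *)
pose eta := Num.min (L / 2) (e * L ^+ 2 / (2 * (L + U))).
have eta0 : 0 < eta.
  by rewrite lt_min !divr_gt0// ?mulr_gt0// exprn_gt0.
have etaL : eta <= L / 2 by rewrite ge_min lexx.
have etae : eta * (2 * (L + U)) <= e * L ^+ 2.
  by rewrite -ler_pdivlMr ?mulr_gt0// ge_min lexx orbT.
have Leta : 0 < L - eta by lra.
have Ueta : 0 <= U + eta by rewrite addr_ge0// ltW.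
have [v vP] := H _ eta0.
have [coord coordP] := choice bS.
pose S w := lincomb v (coord w).
have Slin : linear S.
  move=> a x y; rewrite /S -lincombZ -lincombD; congr (lincomb v _).
  by apply: (lincomb_inj bI); rewrite lincombD lincombZ -!coordP.
pose S' : {linear W -> Y} := HB.pack S (GRing.isLinear.Build R W Y _ S Slin).
have SP w : (L - eta) * `|w| <= `|S w| <= (U + eta) * `|w|.
  by rewrite {1 4}(coordP w); exact: vP.
apply: (@le_trans _ _ (distortion S')).
  apply: ereal_inf_lbound; exists S' => //= x y xy.
  apply/eqP; rewrite -subr_eq0 -normr_le0 -(pmulr_rle0 _ Leta).
  have /andP[/le_trans-> //] := SP (x - y).
  by rewrite -[S]/(S' : W -> Y) linearB/= xy subrr normr0.
apply: (@le_trans _ _ ((U + eta)%:E * (L - eta)^-1%:E)%E); last first.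
  rewrite -EFinM lee_fin ler_pdivrMr//.
  suff : L * (U + eta) <= L * ((U / L + e) * (L - eta)) by rewrite ler_pM2l.
  have -> : L * ((U / L + e) * (L - eta)) = (U + e * L) * (L - eta).
    by field; rewrite gt_eqF.
  have : e * L * eta <= e * L * (L / 2) by rewrite ler_pM2l// mulr_gt0.
  by move: etae; rewrite expr2; nra.
apply: lee_pmul.
- apply: ereal_sup_ubound; exists 0 => /=; rewrite ?normr0//.
  by rewrite -[S]/(S' : W -> Y) linear0 normr0.
- apply: ereal_sup_ubound; exists 0 => /=; rewrite ?normr0//.
  by rewrite -[S]/(S' : W -> Y) linear0 normr0.
- apply: ge_ereal_sup => _ [x /= x1 <-]; rewrite lee_fin.
  have /andP[_ /le_trans->//] := SP x.
  by rewrite ler_piMr.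
- apply: ge_ereal_sup => _ [x /= x1 <-]; rewrite lee_fin.
  have /andP[SPx _] := SP x.
  by rewrite -[leRHS]mul1r ler_pdivlMr// mulrC (le_trans SPx).
Qed.

End FiniteDimension.

(** * Discretization over a probability space *)

Section Partition.
Context d (T : measurableType d) (R : realType) (X : normedModType R).

Lemma measurable_set_lt (u v : T -> R) : measurable_fun setT u ->
  measurable_fun setT v -> measurable [set t | u t < v t].
Proof.
move=> mu mv; have := measurable_fun_ltr mu mv.
move=> /(_ measurableT [set true] I); rewrite setTI.
by congr (measurable _); apply/seteqP; split.
Qed.

Lemma simple_fun_strongly_measurable (f : T -> X) :
  simple_fun f -> strongly_measurable f.
Proof. by move=> sf; exists (fun=> f); split=> // t; exact: cvg_cst. Qed.

Lemma strongly_measurable_dist (f : T -> X) (x : X) :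
  strongly_measurable f -> measurable_fun setT (fun t => `|f t - x|).
Proof.
move=> sf; apply: strongly_measurable_norm.
rewrite (_ : (fun t => _) = 1 *: f + cst (- x)); last first.
  by apply/funext => t; rewrite scale1r.
apply: strongly_measurableZD => //; apply: simple_fun_strongly_measurable.
exact: simple_fun_cst.
Qed.

(** The approximating simple functions take countably many values in all, so countably many tuples
    of centers suffice to come within [g t] of every [f i t]. The tolerance may vary with [t]: a
    constant one serves for a probability, an integrable one for an infinite measure. *)
Lemma strongly_measurable_partition (I : finType) (f : I -> T -> X) (g : T -> R) :
  (forall i, strongly_measurable (f i)) -> measurable_fun setT g ->
  exists (B : (set T)^nat) (x : nat -> I -> X),
    [/\ forall l, measurable (B l), trivIset setT B,
      \bigcup_l B l = [set t | 0 < g t] &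
      forall l i t, B l t -> `|f i t - x l i| < g t].
Proof.
move=> mf mg; have [s sP] := choice mf.
have s_simple i n : simple_fun (s i n) by case: (sP i).
have s_cvg i t : s i n t @[n --> \oo] --> f i t by case: (sP i).
pose D := \bigcup_(ij in [set: I * nat]) range (s ij.1 ij.2).
have cD : countable D.
  apply: bigcup_countable => // ij _.
  by apply: finite_set_countable; case: (s_simple ij.1 ij.2).
have [e De] : exists e : nat -> X, forall x, D x -> exists n, e n = x.
  move: cD => /pfcard_geP[D0|[e]].
    by exists (fun=> 0) => x; rewrite D0.
  by exists e => x Dx; have [n _ nx] := 'surj_e Dx; exists n.
pose E (v : I -> X) :=
  \bigcap_(i in [set: I]) [set t | `|f i t - v i| < g t] `&` [set t | 0 < g t].
have mE v : measurable (E v).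
  apply: measurableI; last by apply: measurable_set_lt => //; exact: measurable_cst.
  apply: fin_bigcap_measurable => // i _; apply: measurable_set_lt => //.
  exact: strongly_measurable_dist.
(* [e] enumerates all the values of the approximating simple functions. *)
pose y l i := if (unpickle l : option {ffun I -> nat}) is Some phi
              then e (phi i) else 0.
(* [seqDU] assigns each point to the first tuple that fits. An index coding no tuple has center 0,
   and the estimate still holds there by definition of [E]. *)
exists (seqDU (E \o y)), y; split.
- by apply: seqDU_measurable => l; exact: mE.
- exact: trivIset_seqDU.
- rewrite -seqDU_bigcup_eq; apply/seteqP; split=> [t [l _ [_]]//|t /= gt0].
  have close i : exists k, `|f i t - e k| < g t.
    have /cvgrPdist_lt/(_ _ gt0)[n _ /(_ n (leqnn n)) /= h] := s_cvg i t.
    have [|k ek] := De (s i n t); first by exists (i, n) => //; exists t.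
    by exists k; rewrite ek.
  have [phi phiP] := choice close.
  exists (pickle [ffun i => phi i]) => //; split=> //= i _ /=.
  by rewrite /y pickleK ffunE.
- by move=> l i t Bt; have [/(_ i Logic.I)] := @subset_seqDU _ (E \o y) l t Bt.
Qed.
End Partition.

(** * Sampling finitely many functions on finitely many cells *)

Section ProbabilityDiscretization.
Context d (T : measurableType d) (R : realType) (mu : probability T R).
Context (V : normedModType R) (n : nat) (f : 'I_n -> T -> V).
Hypothesis mf : forall a, strongly_measurable (f a).

Lemma strongly_measurable_lincomb c :
  strongly_measurable (fun t => lincomb (f ^~ t) c).
Proof.
rewrite (_ : (fun t => _) = \sum_(a < n) c a *: f a); last first.
  by apply/funext => t; rewrite fct_sumE.
elim/big_ind : _ => [|u v mu_ mv|a _].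
- by apply: simple_fun_strongly_measurable; exact: simple_fun_cst.
- by rewrite -[u]scale1r; exact: strongly_measurableZD.
- rewrite -[_ *: _]addr0; apply: strongly_measurableZD => //.
  by apply: simple_fun_strongly_measurable; exact: simple_fun_cst.
Qed.

(** Finitely many cells of a partition with tolerance [eps] carry all but [eps] of the mass; [lam]
    collects their measures and [z] their centers. Neither depends on [c], so one sample serves the
    whole span. *)
Lemma probability_discretization (eps : R) : 0 < eps ->
  exists (m : nat) (lam : 'I_m -> R) (z : 'I_m -> 'I_n -> V),
    [/\ forall l, 0 <= lam l, \sum_(l < m) lam l <= 1 &
    forall c (M : R), {ae mu, forall t, `|lincomb (f ^~ t) c| <= M} ->
      (forall l, `|lincomb (z l) c| <= M + eps * abs_sum c) /\
      (\int[mu]_t `|lincomb (f ^~ t) c|%:E <=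
        (\sum_(l < m) lam l * `|lincomb (z l) c| +
         eps * (abs_sum c + M))%:E)%E].
Proof.
move=> eps0.
have [B [x [mB tB BT xB]]] :=
  strongly_measurable_partition mf (measurable_cst eps : measurable_fun setT (cst eps)).
have {}BT : \bigcup_l B l = setT by rewrite BT; apply/seteqP; split.
have mBm m : measurable (\big[setU/set0]_(l < m) B l) by exact: bigsetU_measurable.
have muB l : mu (B l) \is a fin_num by exact: fin_num_measure.
pose F m := \big[setU/set0]_(l < m) B l.
have muF m : mu (F m) = (\sum_(l < m) mu (B l))%E.
  exact: measure_bigsetU.
(* Otherwise every finite union of cells would have measure below [1 - eps], and so would their
   limit, the whole space. *)
have [m mP] : exists m, (mu (~` F m) <= eps%:E)%E.
  apply: contrapT => /forallNP H.
  have : (mu setT <= (1 - eps)%:E)%E.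
    rewrite -BT measure_bigcup//; apply: lime_le.
      exact: is_cvg_nneseries.
    apply: nearW => m; move: (H m) => /negP; rewrite -ltNge.
    rewrite (probability_setC mu (mBm m)) -/(F m) muF.
    rewrite -(big_mkord xpredT (mu \o B)).
    move=> h.
    under eq_bigl do rewrite in_setT.
    have : (\sum_(0 <= i < m) mu (B i))%E \is a fin_num by apply/sum_fin_numP.
    move: h; case: (\sum_(0 <= i < m) mu (B i))%E => //= r.
    by rewrite -EFinB lte_fin lee_fin => *; lra.
  by rewrite probability_setT lee_fin; lra.
(* An almost everywhere bound says nothing on a null cell, so the sample there is 0; its weight
   vanishes anyway. *)
pose z l a := if mu (B l) == 0%E then 0 else x l a.
exists m, (fun l => fine (mu (B l))), (fun l => z l).
have lam1 : \sum_(l < m) fine (mu (B l)) <= 1.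
  rewrite -lee_fin -sumEFin; under eq_bigr do rewrite fineK//.
  by rewrite -muF; exact: (probability_le1 mu (mBm m)).
split=> [l||c M wM].
- exact: fine_ge0.
- exact: lam1.
have mT0 : (0 < mu setT)%E by rewrite probability_setT.
have aeT := ae_properfilter_algebraOfSetsType mT0.
have M0 : 0 <= M.
  by have [t] := @filter_ex _ _ aeT _ wM; exact: le_trans.
have close l t : B l t -> `|lincomb (f ^~ t) c| <= `|lincomb (x l) c| + eps * abs_sum c.
  by move=> Bt; apply: lincomb_close => a; apply: ltW; exact: xB.
have abs0 := abs_sum_ge0 c.
split=> [l|].
  have [B0|Bl] := eqVneq (mu (B l)) 0%E.
    rewrite /z B0 eqxx /lincomb big1 ?normr0; last by move=> a _; rewrite scaler0.
    by rewrite addr_ge0 ?mulr_ge0 ?(ltW eps0).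
  have -> : z l = x l by rewrite /z; case: eqP Bl.
  (* A cell of positive measure cannot lie inside the exceptional null set. *)
  have [t [Bt wt]] : exists t, B l t /\ `|lincomb (f ^~ t) c| <= M.
    apply: contrapT => /forallNP H; move/eqP: Bl; apply.
    apply/negligibleP => //; apply: negligibleS wM => t Bt /= wt.
    by apply: (H t).
  apply: le_trans (_ : `|lincomb (f ^~ t) c| + eps * abs_sum c <= _).
    by apply: lincomb_close => a; rewrite distrC ltW// xB.
  by rewrite lerD2r.
set E := ~` _ in mP.
have mE : measurable E by apply: measurableC; exact: mBm.
have b0 l : 0 <= `|lincomb (x l) c| + eps * abs_sum c.
  by rewrite addr_ge0 ?mulr_ge0 ?(ltW eps0).
(* The integrand is dominated by [h]: the sampled value plus its error on each chosen cell, and [M]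
   on the remaining set [E], whose measure is at most [eps]. *)
pose u l t := ((`|lincomb (x l) c| + eps * abs_sum c)%:E * (\1_(B l) t)%:E)%E.
have mu_ l : measurable_fun setT (u l).
  by apply: measurable_funeM; apply/measurable_EFinP; exact: measurable_indic.
have u0 l t : (0 <= u l t)%E by rewrite mule_ge0 ?lee_fin.
pose v t := (M%:E * (\1_E t)%:E)%E.
have mv : measurable_fun setT v.
  by apply: measurable_funeM; apply/measurable_EFinP; exact: measurable_indic.
have v0 t : (0 <= v t)%E by rewrite mule_ge0 ?lee_fin.
pose h t := (\sum_(l < m) u l t + v t)%E.
have mh : measurable_fun setT h.
  by apply: emeasurable_funD => //; exact: emeasurable_sum.
apply: (@le_trans _ _ (\int[mu]_t h t)%E).
  apply: ae_ge0_le_integral => //.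
  - by apply/measurable_EFinP/strongly_measurable_norm/strongly_measurable_lincomb.
  - by move=> t _; rewrite adde_ge0// sume_ge0.
  apply: filterS wM => t wM _.
  have [Et|] := pselect (E t).
    apply: lee_paddl; first exact: sume_ge0.
    by rewrite /v indicE mem_set// mule1 lee_fin.
  move=> /contrapT; rewrite /F -bigcup_mkord => -[l /= lm Bt].
  apply: lee_paddr => //; rewrite (bigD1 (Ordinal lm))//=.
  apply: lee_paddr; first exact: sume_ge0.
  by rewrite /u indicE mem_set// mule1 lee_fin close.
rewrite ge0_integralD//; [|by move=> t _; exact: sume_ge0|exact: emeasurable_sum].
rewrite ge0_integral_sum// ge0_integralZl_EFin//; last first.
  by apply/measurable_EFinP; exact: measurable_indic.
rewrite integral_indic// setIT.
have -> : (\sum_(l < m) \int[mu]_t u l t = (\sum_(l < m)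
    fine (mu (B l)) * (`|lincomb (z l) c| + eps * abs_sum c))%:E)%E.
  rewrite -sumEFin; apply: eq_bigr => l _.
  rewrite ge0_integralZl_EFin//; last first.
    by apply/measurable_EFinP; exact: measurable_indic.
  have -> : (\int[mu]_t (\1_(B l) t)%:E = (fine (mu (B l)))%:E)%E.
    by rewrite integral_indic// setIT fineK.
  rewrite -EFinM mulrC /z; congr (_%:E).
  by case: eqVneq => // ->; rewrite !mul0r.
apply: (@le_trans _ _ ((\sum_(l < m)
    fine (mu (B l)) * (`|lincomb (z l) c| + eps * abs_sum c))%:E + M%:E * eps%:E)%E).
  by rewrite leeD2l// lee_wpmul2l// lee_fin.
rewrite -EFinM -EFinD lee_fin.
under eq_bigr do rewrite mulrDr.
rewrite big_split/= -mulr_suml -addrA lerD2l mulrDr (mulrC M) lerD2r.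
by rewrite ler_piMl ?mulr_ge0 ?(ltW eps0).
Qed.
End ProbabilityDiscretization.

(** * Dividing measures *)

Section Nonatomic.
Context d (T : measurableType d) (R : realType).
Variable mu : {measure set T -> \bar R}.
Hypothesis mu_nonatomic : nonatomic mu.

(** Split repeatedly by nonatomicity and keep the part of smaller measure: it stays positive and at
    least halves each time. *)
Lemma nonatomic_small A (e : R) : measurable A -> (0 < mu A < +oo)%E -> 0 < e ->
  exists B, [/\ measurable B, B `<=` A & (0 < mu B <= e%:E)%E].
Proof.
move=> mA /andP[A0 Aoo] e0.
have finA : mu A \is a fin_num by rewrite ge0_fin_numE.
have halve n : exists B,
    [/\ measurable B, B `<=` A & (0 < mu B <= (fine (mu A) / 2 ^+ n)%:E)%E].
  elim: n => [|n [B [mB BA /andP[B0 Bn]]]].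
    by exists A; split => //; rewrite A0 expr0 divr1 fineK/=.
  have [C [mC CB C0 BC0]] := mu_nonatomic mB B0.
  have mBC : measurable (B `\` C) by exact: measurableD.
  have BE : mu B = (mu C + mu (B `\` C))%E.
    by rewrite -measureU ?setDIK// setDUK.
  have Boo : mu B \is a fin_num.
    by rewrite ge0_fin_numE// (le_lt_trans (le_measure _ _ _ BA)) ?inE.
  have Coo : mu C \is a fin_num.
    by rewrite ge0_fin_numE// (le_lt_trans (le_measure _ _ _ CB)) ?inE// -ge0_fin_numE.
  have BCoo : mu (B `\` C) \is a fin_num.
    rewrite ge0_fin_numE// (le_lt_trans (le_measure _ _ _ (@subDsetl _ B C))) ?inE//.
    by rewrite -ge0_fin_numE.
  move: Bn; rewrite BE -(fineK Coo) -(fineK BCoo) -EFinD lee_fin exprS invfM => Bn.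
  have := leP (fine (mu C)) (fine (mu (B `\` C))).
  move=> [CBC|CBC]; [exists C|exists (B `\` C)]; split=> //.
  - exact: subset_trans BA.
  - by rewrite C0/= -(fineK Coo) lee_fin; lra.
  - exact: subset_trans (@subDsetl _ B C) BA.
  - by rewrite BC0/= -(fineK BCoo) lee_fin; lra.
pose N := Num.bound (fine (mu A) / e).
have [B [mB BA /andP[B0 BN]]] := halve N.
exists B; split=> //; rewrite B0/=; apply: le_trans BN _; rewrite lee_fin.
rewrite ler_pdivrMr ?exprn_gt0// mulrC -ler_pdivrMr//.
have /archi_boundP : 0 <= fine (mu A) / e by rewrite divr_ge0 ?fine_ge0 ?ltW.
move/ltW/le_trans; apply.
by rewrite -natrX ler_nat ltnW// ltn_expl.
Qed.

(* Greedy exhaustion: each step adds a set whose measure is at least half of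
   what any admissible set could add, so a deficit would leave room for a small
   set of positive measure that all steps could have added. *)
Lemma nonatomic_intermediate A (c : R) : measurable A -> (mu A < +oo)%E ->
  0 <= c -> (c%:E <= mu A)%E ->
  exists B, [/\ measurable B, B `<=` A & mu B = c%:E].
Proof.
move=> mA Aoo c0 cA.
have fin B : measurable B -> B `<=` A -> mu B \is a fin_num.
  move=> mB BA; rewrite ge0_fin_numE//.
  by rewrite (le_lt_trans (le_measure _ _ _ BA)) ?inE.
pose good E := [/\ measurable E, E `<=` A & (mu E <= c%:E)%E].
pose cand E F := [/\ measurable F, F `<=` A `\` E & (mu E + mu F <= c%:E)%E].
have step E : exists F, good E ->
    cand E F /\ forall F', cand E F' -> fine (mu F') <= 2 * fine (mu F).
  have [gE|] := pselect (good E); last by exists set0.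
  have [mE EA Ec] := gE.
  pose S := [set fine (mu F) | F in cand E].
  have c00 : cand E set0 by split=> //; rewrite measure0 adde0.
  have candA F : cand E F -> F `<=` A by move=> [_ FE _] t /FE[].
  have Sub : ubound S c.
    move=> _ [F [mF FE Fc] <-]; rewrite -lee_fin fineK.
      by apply: le_trans Fc; rewrite leeDr.
    by apply: fin => //; apply: candA.
  have S0 : S 0 by exists set0 => //; rewrite measure0.
  have hS : has_sup S by split; [exists 0|exists c].
  (* If no candidate has positive measure the empty set will do; otherwise some candidate exceeds
     half the supremum. *)
  have [s0|s0] := leP (sup S) 0.
    exists set0 => _; split=> // F' cF'; rewrite measure0/= mulr0.
    by apply: le_trans s0; apply: sup_upper_bound => //; exists F'.
  have s2 : 0 < sup S / 2 by rewrite divr_gt0.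
  have [_ [F cF <-] Fs] := sup_adherent s2 hS.
  exists F => _; split=> // F' cF'.
  have : fine (mu F') <= sup S by apply: sup_upper_bound => //; exists F'.
  by lra.
have [st stP] := choice step.
pose E n := iter n (fun E => E `|` st E) set0.
have goodU X : good X -> good (X `|` st X) /\ mu (X `|` st X) = (mu X + mu (st X))%E.
  move=> gX; have [[mS SX Sc] _] := stP _ gX; have [mX XA Xc] := gX.
  have dis : X `&` st X = set0.
    by apply/seteqP; split=> // t [Xt /SX[]].
  rewrite measureU//; split=> //; split; [exact: measurableU| |].
    by move=> t [/XA|/SX[]].
  by rewrite measureU.
have gE n : good (E n).
  elim: n => [|n /goodU[]//].
  by split; [exact: measurable0|exact: sub0set|rewrite measure0 lee_fin].
have mE n : measurable (E n) by case: (gE n).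
have EA n : E n `<=` A by case: (gE n).
pose B := \bigcup_n E n.
have mB : measurable B by exact: bigcup_measurable.
have BA : B `<=` A by move=> t [n _ /EA].
have Emono : {homo E : n m / (n <= m)%N >-> (n <= m)%O}.
  apply: homo_leq => [X|X Y Z|n]; [exact: lexx|exact: le_trans|].
  by rewrite subsetEset; exact: subsetUl.
have Bc : (mu B <= c%:E)%E.
  have cE : (mu \o E) n @[n --> \oo] --> mu B by exact: nondecreasing_cvg_mu.
  rewrite -(cvg_lim _ cE)//; apply: lime_le; first by apply/cvg_ex; exists (mu B).
  by apply: nearW => n; case: (gE n).
exists B; split=> //; apply/eqP; rewrite eq_le Bc leNgt; apply/negP => ltBc.
have finB := fin _ mB BA.
have mAB : measurable (A `\` B) by exact: measurableD.
have finAB := fin _ mAB (@subDsetl _ A B).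
have AB0 : (0 < mu (A `\` B) < +oo)%E.
  rewrite -ge0_fin_numE// finAB andbT lt0e measure_ge0 andbT; apply/eqP => AB0.
  have AE : mu A = (mu B + mu (A `\` B))%E by rewrite -measureU ?setDIK// setDUK.
  by move: cA; rewrite AE AB0 adde0 leNgt ltBc.
have e0 : 0 < c - fine (mu B) by rewrite subr_gt0 -lte_fin fineK.
have [G [mG GAB /andP[G0 Ge]]] := nonatomic_small mAB AB0 e0.
have finG : mu G \is a fin_num by apply: fin => // t /GAB[].
(* [G] avoids [B], hence every [E n], and its measure fits into the final deficit, hence into each
   earlier one. *)
have candG n : cand (E n) G.
  split=> //; first by move=> t /GAB[At Bt]; split=> // Et; apply: Bt; exists n.
  apply: (@le_trans _ _ (mu B + mu G)%E).
    by apply: leeD => //; apply: le_measure; rewrite ?inE// => t Et; exists n.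
  by rewrite -leeBrDl// -(fineK finB).
have g0 : 0 < fine (mu G) / 2 by rewrite divr_gt0// fine_gt0// G0 -ge0_fin_numE.
have big n : n%:R * (fine (mu G) / 2) <= fine (mu (E n)).
  elim: n => [|n IH]; first by rewrite mul0r fine_ge0.
  have [[mF FA _] /(_ _ (candG n)) FG] := stP _ (gE n).
  have [_ EE] := goodU _ (gE n).
  have finF : mu (st (E n)) \is a fin_num by apply: fin => // t /FA[].
  have -> : fine (mu (E n.+1)) = fine (mu (E n)) + fine (mu (st (E n))).
    by rewrite -fineD//; [rewrite -EE|exact: fin].
  by rewrite mulrSr mulrDl mul1r; lra.
pose N := Num.bound (c / (fine (mu G) / 2)).
have : c / (fine (mu G) / 2) < N%:R by apply/archi_boundP/divr_ge0 => //; exact: ltW.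
rewrite ltr_pdivrMr// => /lt_le_trans/(_ (big N)).
by rewrite -lte_fin fineK ?fin// ltNge; case: (gE N) => _ _ ->.
Qed.
End Nonatomic.

(** * Dividing all cells of a partition in given proportions *)

Section Splitting.
Context d (T : measurableType d) (R : realType).
Variable mu : {measure set T -> \bar R}.

(* The sets [C l i] and the factor [rho i] turn a function with value [x l] on
   [B l] into a copy [rho i *: x l] on [C l i], whose norm is [lam i `^ r^-1]
   times the original one.  The factor is needed because a subset of [nat] has
   no part with a given fraction of its counting measure. *)
Definition copyable (q : \bar R) : Prop :=
  forall (B : (set T)^nat) (m : nat) (lam : 'I_m -> R),
    (forall l, measurable (B l)) -> trivIset setT B ->
    (forall i, 0 <= lam i) -> \sum_(i < m) lam i <= 1 ->
  exists (C : nat -> 'I_m -> set T) (rho : 'I_m -> R),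
    [/\ forall l i, measurable (C l i),
      forall l l' i i' t, C l i t -> C l' i' t -> l = l' /\ i = i',
      forall i, 0 <= rho i &
      match q with
      | r%:E => forall l i, (mu (B l) < +oo)%E ->
          ((rho i `^ r)%:E * mu (C l i) = (lam i)%:E * mu (B l))%E
      | _ => (forall i, rho i = 1) /\
          forall l i, mu (C l i) = 0%E <-> mu (B l) = 0%E
      end].

(** The induction step common to both splittings below: a first piece is prepended to a disjoint
    family. *)
Lemma unlift0_split m (A0 : set T) (A : 'I_m -> set T) (P : 'I_m.+1 -> set T -> Prop) :
  (forall j, A0 `&` A j = set0) -> trivIset setT A ->
  P ord0 A0 -> (forall j, P (lift ord0 j) (A j)) ->
  exists2 C : 'I_m.+1 -> set T, trivIset setT C & forall i, P i (C i).
Proof.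
move=> A0A tA P0 PA.
exists (fun i => oapp A A0 (unlift ord0 i)); last first.
  by move=> i; case: unliftP => [j ->|->] /=.
move=> i j _ _; case: unliftP => [i' ->|->]; case: unliftP => [j' ->|->] //=.
- by move=> h; rewrite (tA i' j').
- by rewrite setIC A0A => /set0P/eqP.
- by rewrite A0A => /set0P/eqP.
Qed.

Hypothesis mu_nonatomic : nonatomic mu.

(** For [q = +oo] only the distinction between null and non-null sets matters, so proportions are
    replaced by this weaker demand, which also makes sense on cells of infinite measure. *)
Lemma nonatomic_split_pos m A : measurable A ->
  exists2 C : 'I_m -> set T, trivIset setT C &
    forall i, [/\ measurable (C i), C i `<=` A & mu (C i) = 0%E <-> mu A = 0%E].
Proof.
elim: m A => [|m IH] A mA.
  by exists (fun=> set0) => [|[]//]; exact: trivIset_set0.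
have [B [mB BA B0 AB0]] : exists B, [/\ measurable B, B `<=` A,
    mu B = 0%E <-> mu A = 0%E & mu (A `\` B) = 0%E <-> mu A = 0%E].
  have [A0|A0] := eqVneq (mu A) 0%E.
    by exists set0; rewrite measure0 setD0 A0; split.
  have [|B [mB BA B0 AB0]] := mu_nonatomic mA; first by rewrite lt0e A0/=.
  by exists B; split=> //; split=> /eqP; rewrite ?(negPf A0)// gt_eqF.
have mAB : measurable (A `\` B) by exact: measurableD.
have [C tC CP] := IH _ mAB.
apply: (unlift0_split (A0 := B) (A := C) (P := fun _ X =>
  [/\ measurable X, X `<=` A & mu X = 0%E <-> mu A = 0%E])) => // j.
  by have [_ CAB _] := CP j; apply/seteqP; split=> // t [Bt /CAB[]].
have [mC CAB C0] := CP j; split=> //; first by move=> t /CAB[].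
by rewrite C0.
Qed.

(** Pieces of prescribed measure are cut off one after the other; the remainder always has room for
    those to come. *)
Lemma nonatomic_split m A (c : 'I_m -> R) : measurable A -> (mu A < +oo)%E ->
  (forall i, 0 <= c i) -> ((\sum_(i < m) c i)%:E <= mu A)%E ->
  exists2 C : 'I_m -> set T, trivIset setT C &
    forall i, [/\ measurable (C i), C i `<=` A & mu (C i) = (c i)%:E].
Proof.
elim: m A c => [|m IH] A c mA Aoo c0 cA.
  by exists (fun=> set0) => [|[]//]; exact: trivIset_set0.
rewrite big_ord_recl in cA.
have cA0 : ((c ord0)%:E <= mu A)%E.
  by apply: le_trans cA; rewrite lee_fin lerDl sumr_ge0.
have [B [mB BA Bc]] := nonatomic_intermediate mu_nonatomic mA Aoo (c0 _) cA0.
have mAB : measurable (A `\` B) by exact: measurableD.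
have AE : mu A = (mu B + mu (A `\` B))%E by rewrite -measureU ?setDIK// setDUK.
have ABoo : (mu (A `\` B) < +oo)%E.
  by rewrite (le_lt_trans _ Aoo)// AE leeDr.
have cAB : ((\sum_(i < m) c (lift ord0 i))%:E <= mu (A `\` B))%E.
  by move: cA; rewrite AE Bc EFinD leeD2lE.
have [C tC CP] := IH _ (fun i => c (lift ord0 i)) mAB ABoo (fun i => c0 _) cAB.
apply: (unlift0_split (A0 := B) (A := C) (P := fun i X =>
  [/\ measurable X, X `<=` A & mu X = (c i)%:E])) => // j.
  by have [_ CAB _] := CP j; apply/seteqP; split=> // t [Bt /CAB[]].
by have [mC CAB C0] := CP j; split=> // t /CAB[].
Qed.

(** Pieces of each cell of measure [lam i * mu (B l)] carry the right mass without rescaling, so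
    [rho] is 1. *)
Lemma nonatomic_copyable q : (1 <= q)%E -> copyable q.
Proof.
move=> q1 B m lam mB tB lam0 lam1.
have H l : exists C : 'I_m -> set T, trivIset setT C /\ forall i,
    [/\ measurable (C i), C i `<=` B l & match q with
      | r%:E => (mu (B l) < +oo)%E -> mu (C i) = ((lam i)%:E * mu (B l))%E
      | _ => mu (C i) = 0%E <-> mu (B l) = 0%E
      end].
  case: q q1 => [r|_|//]; last first.
    by have [C tC CP] := nonatomic_split_pos m (mB l); exists C.
  have [Boo|Boo] := pselect (mu (B l) < +oo)%E; last first.
    (* For finite [q] nothing is demanded of a cell of infinite measure, so empty pieces do. *)
    exists (fun=> set0); split; first exact: trivIset_set0.
    by move=> i; split.
  have finB : mu (B l) \is a fin_num by rewrite ge0_fin_numE.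
  have c0 i : 0 <= lam i * fine (mu (B l)) by rewrite mulr_ge0 ?fine_ge0.
  have cB : ((\sum_(i < m) lam i * fine (mu (B l)))%:E <= mu (B l))%E.
    by rewrite -[leRHS]fineK// lee_fin -mulr_suml ler_piMl ?fine_ge0.
  have [C tC CP] := nonatomic_split (mB l) Boo c0 cB.
  exists C; split=> // i; have [mC CB ->] := CP i; split=> // _.
  by rewrite EFinM fineK.
have [C CP] := choice H.
have mC l i : measurable (C l i) by case: (CP l) => _ /(_ i)[].
have CB l i : C l i `<=` B l by case: (CP l) => _ /(_ i)[].
exists C, (fun=> 1); split=> //.
  move=> l l' i i' t Cli Cli'.
  have ll' : l = l' by apply: (tB l l') => //; exists t; split;
    [exact: CB Cli|exact: CB Cli'].
  subst l'; split=> //; case: (CP l) => tC _.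
  by apply: (tC i i') => //; exists t.
case: q q1 H CP => [r _ _ CP l i Boo|_ _ CP|//].
  by have [_ /(_ i)[_ _ ->//]] := CP l; rewrite powR1 mul1e.
by split=> // l i; have [_ /(_ i)[_ _]] := CP l.
Qed.

End Splitting.

(** * The counting measure *)

Section Counting.
Context (R : realType).
Let mu : {measure set nat -> \bar R} := @counting nat R.

Lemma counting_inj_image (f : nat -> nat) (A : set nat) :
  injective f -> mu (f @` A) = mu A.
Proof.
move=> fI; rewrite /mu/= /counting.
have AfA : (f @` A #= A)%card by apply: inj_card_eq; exact: in2W.
rewrite (eq_finite_set AfA); case: asboolP => // finA.
by rewrite fset_set_image// finmap.card_imfset.
Qed.

(** The injection of [n] to [n * m + i] moves [B l] into the residue class of [i] modulo [m]: the
    images are disjoint and keep their measure. The weight goes entirely into [rho i], the [r]-th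
    root of [lam i]. *)
Lemma counting_copyable q : (1 <= q)%E -> copyable mu q.
Proof.
move=> q1 B m lam mB tB lam0 lam1.
exists (fun l (i : 'I_m) => (fun n => n * m + i)%N @` B l),
  (fun i => if q is r%:E then lam i `^ r^-1 else 1).
split=> //.
- move=> l l' i i' _ [n Bn <-] [n' Bn' nE].
  have m0 : (0 < m)%N by case: m i {lam lam0 lam1 i' nE} => [[]|].
  have ii' : i = i'.
    apply/val_inj; move: (congr1 (modn^~ m) nE).
    by rewrite !modnMDl !modn_small.
  subst i'; split=> //.
  have nn' : n = n' by move/addIn: nE => /eqP; rewrite eqn_pmul2r// => /eqP.
  by apply: (tB l l') => //; exists n; split=> //; rewrite nn'.
- by move=> i; case: q q1 => // r _; exact: powR_ge0.
have E l (i : 'I_m) : mu ((fun n => n * m + i)%N @` B l) = mu (B l).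
  apply: counting_inj_image => n n' /addIn/eqP.
  by rewrite eqn_pmul2r; [move/eqP|case: m i {lam lam0 lam1} => [[]|]].
case: q q1 => [r r1 l i _|_|//]; last by split=> // l i; rewrite E.
have r0 : 0 < r by rewrite -lte_fin (lt_le_trans _ r1)// lte01.
by rewrite E -powRrM mulVf ?gt_eqF// powRr1.
Qed.
End Counting.

(** * Norms in Lebesgue-Bochner spaces *)

Section BochnerNorm.
Context d (T : measurableType d) (R : realType).
Variable mu : {measure set T -> \bar R}.
Variables (q : \bar R) (q1 : (1 <= q)%E) (X : normedModType R).
Local Notation bfun := (bochner_fun mu q1 X).
Local Notation bspace := (bochner_space mu q1 X).

Lemma bochner_fun_sumE (I : Type) (r : seq I) (F : I -> bfun) t :
  (\sum_(i <- r) F i) t = \sum_(i <- r) F i t.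
Proof.
elim: r => [|i r IH]; first by rewrite !big_nil.
by rewrite !big_cons -IH.
Qed.

Lemma bochner_class_lincomb n (f : 'I_n -> bfun) c :
  lincomb (fun a => bochner_class (f a) : bspace) c = bochner_class (lincomb f c).
Proof.
rewrite /lincomb [RHS]raddf_sum.
by apply: eq_bigr => a _; rewrite bochner_scaleE.
Qed.

Lemma bochner_lincombE n (f : 'I_n -> bfun) c t :
  lincomb f c t = lincomb (fun a => f a t) c.
Proof. by rewrite bochner_fun_sumE. Qed.

Lemma norm_class_lincomb n (f : 'I_n -> bfun) c :
  `|lincomb (fun a => bochner_class (f a) : bspace) c|%:E =
  bochner_norm mu q (fun t => lincomb (fun a => f a t) c).
Proof.
rewrite bochner_class_lincomb bochner_space_normE; congr bochner_norm.
by apply/funext => t; exact: bochner_lincombE.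
Qed.

Lemma bochner_norm_poweR (F : T -> X) (r : R) : r != 0 ->
  (bochner_norm mu r%:E F `^ r = \int[mu]_t (`|F t| `^ r)%:E)%E.
Proof.
move=> r0; rewrite /bochner_norm poweR_Lnorm//.
by apply: eq_integral => t _; rewrite -poweR_EFin /= normr_id.
Qed.

Lemma bochner_norm_oo_le (F : T -> X) (M : R) : 0 <= M ->
  ((bochner_norm mu +oo F <= M%:E)%E <-> {ae mu, forall t, `|F t| <= M}).
Proof.
move=> M0; rewrite /bochner_norm unlock /Lnorm; case: ifPn => [_|].
  split=> [/ess_supP|H]; last apply/ess_supP.
    by apply: filterS => t /=; rewrite lee_fin normr_id.
  by apply: filterS H => t /=; rewrite lee_fin normr_id.
(* On a space of measure zero the norm is 0 by convention, and every property holds almost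
   everywhere. *)
rewrite lt0e measure_ge0 andbT negbK => /eqP T0; split=> // _.
by exists setT; split.
Qed.

End BochnerNorm.

(** * Step functions with countably many values *)

Section StepFunction.
Context d (T : measurableType d) (R : realType).
Variable mu : {measure set T -> \bar R}.
Context (X : normedModType R).
Implicit Types (B : (set T)^nat) (phi : nat -> X).

(** Choosing an index avoids an infinite sum of indicators; for disjoint [B] the index is unique. *)
Definition step_fun B phi (t : T) : X :=
  if pselect (exists l, B l t) is left h then phi (projT1 (cid h)) else 0.

Lemma step_fun_in B phi l t : trivIset setT B -> B l t -> step_fun B phi t = phi l.
Proof.
move=> tB Bt; rewrite /step_fun; case: pselect => [h|]; last by case; exists l.
by case: cid => l' /= Bt'; rewrite (tB l' l)//; exists t.
Qed.

Lemma step_fun_out B phi t : (forall l, ~ B l t) -> step_fun B phi t = 0.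
Proof.
move=> nB; rewrite /step_fun; case: pselect => // h.
by exfalso; case: h => l /nB.
Qed.

Lemma step_fun_lincomb B n (phi : 'I_n -> nat -> X) c t :
  lincomb (fun a => step_fun B (phi a) t) c =
  step_fun B (fun l => lincomb (phi ^~ l) c) t.
Proof.
rewrite /step_fun; case: pselect => // _.
by rewrite /lincomb big1// => a _; rewrite scaler0.
Qed.

Context (B : (set T)^nat).
Hypothesis mB : forall l, measurable (B l).
Hypothesis tB : trivIset setT B.

Lemma step_fun_case t : (exists2 l, B l t & forall phi, step_fun B phi t = phi l)
  \/ ((forall l, ~ B l t) /\ forall phi, step_fun B phi t = 0).
Proof.
have [[l Bt]|nB] := pselect (exists l, B l t).
  by left; exists l => // phi; exact: step_fun_in.
have {}nB l : ~ B l t by move=> Bt; apply: nB; exists l.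
by right; split=> // phi; exact: step_fun_out.
Qed.

(** Restricting to the first [n] cells gives simple functions that are eventually constant at every
    point. *)
Lemma step_fun_strongly_measurable phi : strongly_measurable (step_fun B phi).
Proof.
pose Bn n l := if (l < n)%N then B l else set0.
have mBn n l : measurable (Bn n l) by rewrite /Bn; case: ifP.
have tBn n : trivIset setT (Bn n).
  move=> i j _ _ [t []]; rewrite /Bn; case: ifP => //; case: ifP => // _ _ Bi Bj.
  by apply: tB => //; exists t.
exists (fun n => step_fun (Bn n) phi); split=> [n|t].
  split.
    apply: (@sub_finite_set _ _ ([set 0] `|` phi @` `I_n)).
      move=> _ [t _ <-]; have [[l Bt]|nB] := pselect (exists l, Bn n l t).
        right; exists l; last by rewrite (step_fun_in _ (tBn n) Bt).
        by move: Bt; rewrite /Bn/=; case: ifP.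
      by left; apply: step_fun_out => l Bt; apply: nB; exists l.
    by rewrite finite_setU; split; [exact: finite_set1|exact/finite_image/finite_II].
  move=> x.
  (* The value 0 is also taken off the cells, so the complement joins its preimage. *)
  have -> : step_fun (Bn n) phi @^-1` [set x] =
      (\bigcup_(l in [set l | phi l = x]) Bn n l) `|`
      (if `[< x = 0 >] then ~` \bigcup_l Bn n l else set0).
    apply/seteqP; split=> [t /= xE|t []].
    - have [[l Bt]|nB] := pselect (exists l, Bn n l t).
        by left; exists l => //=; rewrite -xE (step_fun_in _ (tBn n) Bt).
      right; rewrite -xE step_fun_out; last by move=> l Bt; apply: nB; exists l.
      by rewrite asboolT// => -[l _ Bt]; apply: nB; exists l.
    - by move=> [l /= <- Bt]; rewrite /= (step_fun_in _ (tBn n) Bt).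
    - case: asboolP => // -> nB /=; apply: step_fun_out => l Bt.
      by apply: nB; exists l.
  apply: measurableU; first exact: bigcup_measurable.
  by case: asboolP => // _; apply: measurableC; exact: bigcup_measurable.
apply: cvg_near_cst; have [[l Bt ->]|[nB ->]] := step_fun_case t.
  exists l.+1 => // n /= ln; apply: (@step_fun_in _ _ l) => //.
  by rewrite /Bn ln.
apply: nearW => n; apply: step_fun_out => l; rewrite /Bn.
by case: ifP => [_|_ []]; exact: nB.
Qed.

Lemma integral_step_fun phi (r : R) : r != 0 ->
  (\int[mu]_t (`|step_fun B phi t| `^ r)%:E =
   \sum_(l <oo) ((`|phi l| `^ r)%:E * mu (B l)))%E.
Proof.
move=> r0.
have mstep : measurable_fun setT (fun t => (`|step_fun B phi t| `^ r)%:E).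
  apply/measurable_EFinP; apply: (measurableT_comp (measurable_powR r)).
  exact: strongly_measurable_norm (step_fun_strongly_measurable phi).
have -> : (\int[mu]_t (`|step_fun B phi t| `^ r)%:E =
    \int[mu]_(t in \bigcup_l B l) (`|step_fun B phi t| `^ r)%:E)%E.
  rewrite [RHS]integral_mkcond; apply: eq_integral => t _; rewrite patchE.
  case: ifPn => //; rewrite notin_setE => nB.
  by rewrite step_fun_out ?normr0 ?powR0// => l Bt; apply: nB; exists l.
rewrite ge0_integral_bigcup//; last first.
  by apply: measurable_funS mstep.
apply: eq_eseriesr => l _.
rewrite (eq_integral (cst (`|phi l| `^ r)%:E)) ?integral_cst// => t.
by rewrite inE => Bt; rewrite (step_fun_in _ tB Bt).
Qed.

(** A violation on a non-null cell would happen on the whole cell; the null cells are countably many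
    and hence negligible together. *)
Lemma ae_step_fun_le phi (M : R) : 0 <= M ->
  {ae mu, forall t, `|step_fun B phi t| <= M} <->
  (forall l, mu (B l) != 0%E -> `|phi l| <= M).
Proof.
move=> M0; split=> [H l Bl|H].
  rewrite leNgt; apply/negP => Ml; move/eqP: Bl; apply; apply/negligibleP => //.
  apply: negligibleS H => t Bt /=.
  by rewrite (step_fun_in _ tB Bt) leNgt Ml.
apply: (@negligibleS _ _ _ _ (\bigcup_(l in [set l | mu (B l) = 0%E]) B l)).
  move=> t /= /negP; rewrite -ltNge.
  have [[l Bt ->]|[_ ->]] := step_fun_case t; last by rewrite normr0 ltNge M0.
  move=> Ml; exists l => //=; apply/eqP; apply: contraTT Ml => /H.
  by rewrite -leNgt.
rewrite bigcup_mkcond; apply: negligible_bigcup => l.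
by case: ifPn => [|_]; [rewrite inE => Bl0; exact/negligibleP|exact: negligible_set0].
Qed.

End StepFunction.

(** * Copies in Lebesgue-Bochner spaces *)

Section PowersAndSeries.
Context (R : realType).

Lemma powR_mul_pred (x r : R) : 0 <= x -> r != 0 -> x * x `^ (r - 1) = x `^ r.
Proof.
move=> x0 r0; have [->|xN0] := eqVneq x 0; first by rewrite mul0r powR0.
by rewrite -[X in X * _ = _]powRr1// -powRD ?xN0 ?implybT// addrC subrK.
Qed.

Lemma powRVK (x r : R) : 0 <= x -> r != 0 -> (x `^ r) `^ r^-1 = x.
Proof. by move=> x0 r0; rewrite -powRrM mulfV// powRr1. Qed.

(* Sum Young's inequality for the products [y i * s `^ (r - 1)], with [s] the
   weighted mean of the [y i]. *)
Lemma powR_wmean_le m (lam y : 'I_m -> R) (r : R) : 1 <= r ->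
  (forall i, 0 <= lam i) -> \sum_(i < m) lam i <= 1 -> (forall i, 0 <= y i) ->
  (\sum_(i < m) lam i * y i) `^ r <= \sum_(i < m) lam i * y i `^ r.
Proof.
move=> r1 lam0 lam1 y0; have r0 : 0 < r by exact: lt_le_trans r1.
set s := \sum_(i < m) lam i * y i.
have s0 : 0 <= s by apply: sumr_ge0 => i _; exact: mulr_ge0.
move: r1; rewrite le_eqVlt => /predU1P[<-|r1].
  rewrite powRr1//; apply: ler_sum => i _.
  by rewrite powRr1.
have rN0 : r != 0 by rewrite gt_eqF.
have r10 : 0 < r - 1 by lra.
have Young i : y i * s `^ (r - 1) <= y i `^ r / r + s `^ r * (1 - r^-1).
  have := @conjugate_powR _ (y i) (s `^ (r - 1)) r (r / (r - 1))
    (y0 i) (powR_ge0 _ _) r0.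
  rewrite -powRrM divr_gt0// invf_div.
  have -> : (r - 1) * (r / (r - 1)) = r by field; rewrite gt_eqF.
  have -> : (r - 1) / r = 1 - r^-1 by field.
  by apply => //; lra.
have : s * s `^ (r - 1) <= (\sum_(i < m) lam i * y i `^ r) / r +
    s `^ r * (1 - r^-1) * \sum_(i < m) lam i.
  rewrite mulr_suml mulr_suml mulr_sumr -big_split/=; apply: ler_sum => i _.
  by have := ler_wpM2l (lam0 i) (Young i); lra.
rewrite powR_mul_pred//.
have sr0 := powR_ge0 s r.
have r'0 : 0 <= 1 - r^-1 by rewrite subr_ge0 invf_le1// ltW.
move=> H; have {}H : s `^ r <= (\sum_(i < m) lam i * y i `^ r) / r + s `^ r * (1 - r^-1).
  apply: le_trans H _; rewrite lerD2l; apply: ler_piMr => //.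
  exact: mulr_ge0.
suff : s `^ r / r <= (\sum_(i < m) lam i * y i `^ r) / r by rewrite ler_pM2r ?invr_gt0.
by move: H; rewrite mulrBr mulr1; lra.
Qed.
Lemma nneseries_le_term (u : nat -> \bar R) l : (forall k, (0 <= u k)%E) ->
  (u l <= \sum_(k <oo) u k)%E.
Proof.
move=> u0; apply: (@le_trans _ _ (\sum_(0 <= k < l.+1) u k)%E).
  by rewrite big_nat_recr//= leeDr// sume_ge0.
exact: nneseries_lim_ge.
Qed.

End PowersAndSeries.

(** * Disjoint weighted copies of step functions *)

Section Copies.
Context d (T : measurableType d) (R : realType).
Variable mu : {measure set T -> \bar R}.
Variables (q : \bar R) (q1 : (1 <= q)%E) (X : normedModType R).
Local Notation bfun := (bochner_fun mu q1 X).
Local Notation bspace := (bochner_space mu q1 X).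
Hypothesis cop : copyable mu q.

Definition classes n (u : 'I_n -> bfun) : 'I_n -> bspace :=
  fun a => bochner_class (u a).

(** The terms agree one by one. A cell of infinite measure, for which nothing is assumed, must carry
    the value 0, since the series is finite. *)
Lemma weighted_series_copy (B C : (set T)^nat) (rho lam r : R) (g : nat -> X) :
  0 < r -> 0 <= rho ->
  (forall l, (mu (B l) < +oo)%E -> ((rho `^ r)%:E * mu (C l) = lam%:E * mu (B l))%E) ->
  0 <= lam ->
  (\sum_(l <oo) ((`|g l| `^ r)%:E * mu (B l)) < +oo)%E ->
  (\sum_(l <oo) ((`|rho *: g l| `^ r)%:E * mu (C l)) =
   lam%:E * \sum_(l <oo) ((`|g l| `^ r)%:E * mu (B l)))%E.
Proof.
move=> r0 rho0 H lam0 fin.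
have t0 l : (0 <= (`|g l| `^ r)%:E * mu (B l))%E by rewrite mule_ge0// lee_fin powR_ge0.
rewrite -nneseriesZl//; apply: eq_eseriesr => l _.
have [g0|gN0] := eqVneq (g l) 0.
  by rewrite g0 scaler0 normr0 powR0 ?gt_eqF// !mul0e mule0.
have gr0 : 0 < `|g l| `^ r by rewrite powR_gt0// normr_gt0.
rewrite normrZ ger0_norm// powRM// mulrC EFinM -muleA H; first by rewrite muleCA.
rewrite ltNge leye_eq; apply/negP => /eqP Boo.
have := le_lt_trans (nneseries_le_term l t0) fin.
by rewrite Boo gt0_muley// lte_fin.
Qed.

Lemma step_norm_oo_le (B : (set T)^nat) (phi : nat -> X) (M : R) :
  (forall l, measurable (B l)) -> trivIset setT B -> 0 <= M ->
  (bochner_norm mu +oo (step_fun B phi) <= M%:E)%E <->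
  (forall l, mu (B l) != 0%E -> `|phi l| <= M).
Proof.
move=> mB tB M0; rewrite -(ae_step_fun_le mu mB tB phi M0).
exact: bochner_norm_oo_le.
Qed.

(** The copies have disjoint supports. For finite [q = r] the [r]-th power of the norm of their sum
    is the weighted sum of the [r]-th powers, between which and the weighted mean stands the power
    mean inequality; for [q = +oo] the norm is the maximum. For step functions no error term
    arises. *)
Lemma step_copies n m (lam : 'I_m -> R) (B : (set T)^nat)
    (phi : 'I_m -> 'I_n -> nat -> X) (u : 'I_m -> 'I_n -> bfun) :
  (forall l, measurable (B l)) -> trivIset setT B ->
  (forall i a t, u i a t = step_fun B (phi i a) t) ->
  (forall i, 0 <= lam i) -> \sum_(i < m) lam i <= 1 ->
  exists v : 'I_n -> bspace, forall c,
    \sum_(i < m) lam i * `|lincomb (classes (u i)) c| <= `|lincomb v c| /\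
    forall M, 0 <= M -> (forall i, `|lincomb (classes (u i)) c| <= M) ->
      `|lincomb v c| <= M.
Proof.
move=> mB tB uE lam0 lam1.
have [C [rho [mC tC rho0 CP]]] := cop mB tB lam0 lam1.
have tCi i : trivIset setT (C ^~ i).
  by move=> l l' _ _ [t [Cl Cl']]; have [] := tC _ _ _ _ _ Cl Cl'.
have uN i c : `|lincomb (classes (u i)) c|%:E =
    bochner_norm mu q (step_fun B (fun l => lincomb (phi i ^~ l) c)).
  rewrite norm_class_lincomb; congr bochner_norm; apply/funext => t.
  by rewrite -step_fun_lincomb; congr lincomb; apply/funext => a; exact: uE.
have uN1 i a : (bochner_norm mu q (step_fun B (phi i a)) < +oo)%E.
  rewrite -(_ : bochner_norm mu q (u i a) = bochner_norm mu q (step_fun B (phi i a))).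
    exact: bochner_fun_finite_norm.
  by congr bochner_norm; apply/funext => t; exact: uE.
pose V i a := step_fun (C ^~ i) (fun l => rho i *: phi i a l).
have Vmem i a : V i a \in bochner_pred mu q1.
  rewrite inE; split; first exact: step_fun_strongly_measurable.
  case: (q) q1 CP (uN1 i a) => [r r1|_|//] CP uN1'.
    have r0 : 0 < r by rewrite -lte_fin (lt_le_trans lte01 r1).
    have rN0 : r != 0 by rewrite gt_eqF.
    apply: (lty_poweRy rN0); rewrite bochner_norm_poweR// integral_step_fun//.
    have fin : (\sum_(l <oo) ((`|phi i a l| `^ r)%:E * mu (B l)) < +oo)%E.
      by rewrite -integral_step_fun// -bochner_norm_poweR// poweR_lty.
    rewrite (weighted_series_copy r0 (rho0 i) (CP ^~ i) (lam0 i) fin).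
    by rewrite lte_mul_pinfty// lee_fin.
  have [M M0 uM] : exists2 M, 0 <= M &
      (bochner_norm mu +oo (step_fun B (phi i a)) <= M%:E)%E.
    exists (fine (bochner_norm mu +oo (step_fun B (phi i a)))).
      by apply: fine_ge0; exact: Lnorm_ge0.
    by rewrite fineK// ge0_fin_numE//; exact: Lnorm_ge0.
  apply: (@le_lt_trans _ _ M%:E); last exact: ltry.
  apply/(step_norm_oo_le _ (mC ^~ i) (tCi i) M0) => l Cl.
  have [rho1 C0] := CP; rewrite rho1 scale1r.
  move/(step_norm_oo_le _ mB tB M0) : uM; apply.
  by apply: contra Cl => /eqP/C0/eqP.
pose W a : bfun := \sum_(i < m) BochnerFun (Vmem i a).
exists (classes W) => c.
pose g i l := lincomb (phi i ^~ l) c.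
have WN : `|lincomb (classes W) c|%:E = bochner_norm mu q
    (fun t => \sum_(i < m) step_fun (C ^~ i) (fun l => rho i *: g i l) t).
  rewrite norm_class_lincomb; congr bochner_norm; apply/funext => t.
  under [X in lincomb X]eq_fun do rewrite bochner_fun_sumE.
  rewrite lincomb_sum; apply: eq_bigr => i _ /=.
  rewrite /V step_fun_lincomb; congr step_fun.
  by apply/funext => l; rewrite lincomb_scale.
have single t : (forall i, step_fun (C ^~ i) (fun l => rho i *: g i l) t = 0) \/
    exists i, forall j, j != i -> step_fun (C ^~ j) (fun l => rho j *: g j l) t = 0.
  have [[i [l Ct]]|nC] := pselect (exists i l, C l i t).
    right; exists i => j ji; apply: step_fun_out => l' Ct'.
    by have [_ ij] := tC _ _ _ _ _ Ct Ct'; rewrite ij eqxx in ji.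
  by left=> i; apply: step_fun_out => l Ct; apply: nC; exists i, l.
pose S i t := step_fun (C ^~ i) (fun l => rho i *: g i l) t.
(* The norms are abstracted to real numbers because their types depend on [q], which is now split
   into cases. *)
suff H (al : 'I_m -> R) (be : R) : (forall i, 0 <= al i) -> 0 <= be ->
    (forall i, (al i)%:E = bochner_norm mu q (step_fun B (g i))) ->
    be%:E = bochner_norm mu q (fun t => \sum_(i < m) S i t) ->
    \sum_(i < m) lam i * al i <= be /\
    forall M, 0 <= M -> (forall i, al i <= M) -> be <= M.
  by apply: H => //; exact: (uN ^~ c).
move=> al0 be0 alE beE.
case: (q) q1 CP alE beE => [r r1|_|//] CP alE beE.
  have {}r1 : 1 <= r by [].
  have r0 : 0 < r by exact: lt_le_trans r1.
  have rN0 : r != 0 by rewrite gt_eqF.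
  have alr i : ((al i `^ r)%:E = \sum_(l <oo) ((`|g i l| `^ r)%:E * mu (B l)))%E.
    by rewrite -poweR_EFin alE bochner_norm_poweR// integral_step_fun.
  have Sr i : (\int[mu]_t (`|S i t| `^ r)%:E = (lam i * al i `^ r)%:E)%E.
    rewrite integral_step_fun// (weighted_series_copy r0 (rho0 i) (CP ^~ i) (lam0 i)).
      by rewrite -alr.
    by rewrite -alr ltry.
  have mS i : measurable_fun setT (fun t => (`|S i t| `^ r)%:E).
    apply/measurable_EFinP; apply: (measurableT_comp (measurable_powR r)).
    apply: strongly_measurable_norm; exact: step_fun_strongly_measurable.
  (* At each point at most one summand is nonzero, so the power of the sum is the sum of the
     powers. *)
  have ber : be `^ r = \sum_(i < m) lam i * al i `^ r.
    apply: EFin_inj; rewrite -poweR_EFin beE bochner_norm_poweR// -sumEFin.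
    under [RHS]eq_bigr do rewrite -Sr.
    rewrite -ge0_integral_sum//.
    apply: eq_integral => t _; rewrite sumEFin; congr (_%:E).
    have [S0|[i Si]] := single t.
      rewrite big1 ?normr0 ?powR0 ?big1//; last by move=> i _; exact: S0.
      by move=> i _; rewrite /S S0 normr0 powR0.
    rewrite (bigD1 i)//= big1 ?addr0; last by move=> j /Si.
    rewrite [RHS](bigD1 i)//= [X in _ + X]big1 ?addr0// => j /Si.
    by rewrite /S => ->; rewrite normr0 powR0.
  split=> [|M M0 uM].
    rewrite leNgt; apply/negP => /(gt0_ltr_powR r0).
    rewrite !nnegrE be0 sumr_ge0; last by move=> i _; exact: mulr_ge0.
    by move=> /(_ isT isT); rewrite ber ltNge powR_wmean_le.
  rewrite leNgt; apply/negP => /(gt0_ltr_powR r0).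
  rewrite !nnegrE be0 M0 => /(_ isT isT); rewrite ber ltNge => /negP; apply.
  apply: (@le_trans _ _ (\sum_(i < m) lam i * M `^ r)).
    by apply: ler_sum => i _; rewrite ler_wpM2l// ge0_ler_powR ?nnegrE ?(ltW r0).
  by rewrite -mulr_suml ler_piMl ?powR_ge0.
have [rho1 C0] := CP.
(* With [rho] equal to 1 and null cells matching null cells, a copy has the same essential bounds as
   its original. *)
have Sg i M : 0 <= M ->
    {ae mu, forall t, `|S i t| <= M} <-> al i <= M.
  move=> M0; rewrite (ae_step_fun_le mu (mC ^~ i) (tCi i) _ M0) -lee_fin alE.
  rewrite (step_norm_oo_le _ mB tB M0).
  have BC l : mu (B l) != 0%E <-> mu (C l i) != 0%E.
    by split; apply: contra => /eqP/C0/eqP.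
  split=> H l => [/BC|/BC] /H; by rewrite rho1 scale1r.
have alM i : al i <= be.
  apply/Sg => //.
  have : (bochner_norm mu +oo (fun t => (\sum_(i < m) S i t)%R) <= be%:E)%E.
    by rewrite -beE.
  move=> /(bochner_norm_oo_le _ _ be0); apply: filterS => t.
  have [S0 _|[j Sj]] := single t; first by rewrite /S S0 normr0.
  rewrite (bigD1 j)//= big1 ?addr0; last by move=> k /Sj.
  by have [->//|/Sj] := eqVneq i j; rewrite /S => ->; rewrite normr0.
split=> [|M M0 uM].
  apply: (@le_trans _ _ (\sum_(i < m) lam i * be)).
    by apply: ler_sum => i _; exact: ler_wpM2l.
  by rewrite -mulr_suml ler_piMl.
rewrite -lee_fin beE; apply/bochner_norm_oo_le => //.
have : {ae mu, forall t, forall i, `|S i t| <= M}.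
  by apply: filter_forall => i; apply/Sg.
apply: filterS => t SM; have [S0|[i Si]] := single t.
  by rewrite big1 ?normr0// => i _; exact: S0.
by rewrite (bigD1 i)//= big1 ?addr0// => j /Si.
Qed.
End Copies.

(** * Copies of arbitrary functions, by approximation *)

Section LqCopies.
Context d (T : measurableType d) (R : realType).
Variable mu : {measure set T -> \bar R}.
Variables (q : \bar R) (q1 : (1 <= q)%E) (X : normedModType R).
Local Notation bfun := (bochner_fun mu q1 X).
Local Notation bspace := (bochner_space mu q1 X).

(** Pointwise norms are themselves elements of a scalar [L_q] space, where they can be added to form
    a dominating function. *)
Lemma normr_bochner_pred (F : bfun) :
  (fun t => `|F t| : R^o) \in bochner_pred mu q1.
Proof.
rewrite inE; split.
  have [s [ss sF]] := bochner_fun_strongly_measurable F.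
  exists (fun n t => `|s n t| : R^o); split=> [n|t]; last exact: (cvg_norm (sF t)).
  split=> [|x]; last exact: (simple_fun_preimage (normr @^-1` [set x]) (ss n)).
  apply: (@sub_finite_set _ _ (normr @` range (s n))).
    by move=> _ [t _ <-]; exists (s n t) => //; exists t.
  by apply: finite_image; case: (ss n).
have := bochner_fun_finite_norm F; congr (_ < _)%E.
by apply: eq_Lnorm => t /=; rewrite normr_id.
Qed.

Lemma bochner_pred_le (F : T -> X) (G : bochner_fun mu q1 R^o) :
  strongly_measurable F -> (forall t, `|F t| <= G t) ->
  F \in bochner_pred mu q1 /\ (bochner_norm mu q F <= `|bochner_class G|%:E)%E.
Proof.
move=> mF FG.
have FN : (bochner_norm mu q F <= `|bochner_class G|%:E)%E.
  rewrite bochner_space_normE; apply: le_Lnorm => //.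
  - exact: strongly_measurable_norm.
  - exact/strongly_measurable_norm/bochner_fun_strongly_measurable.
  - by move=> t; rewrite normr_ge0 (le_trans (FG t)) ?ler_norm.
by split=> //; rewrite inE; split=> //; exact: le_lt_trans FN (ltry _).
Qed.

(* The pointwise error is at most [e' * sum_i |f i|], a function of [L_q]; a
   uniform error would not be in [L_q] when the measure is infinite. *)
Lemma bochner_step_approximation (I : finType) (f : I -> bspace) (e : R) : 0 < e ->
  exists (B : (set T)^nat) (x : nat -> I -> X) (u : I -> bfun),
    [/\ forall l, measurable (B l), trivIset setT B,
      forall i t, u i t = step_fun B (x ^~ i) t &
      forall i, `|bochner_class (u i) - f i| <= e].
Proof.
move=> e0.
pose F i := bochner_repr (f i).
pose G : bochner_fun mu q1 R^o := \sum_i BochnerFun (normr_bochner_pred (F i)).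
have GE t : G t = \sum_i `|F i t| by exact: bochner_fun_sumE.
pose N := `|bochner_class G|.
have N0 : 0 <= N by exact: normr_ge0.
(* Adding 1 keeps the denominator positive when all the functions vanish. *)
pose e' := e / (N + 1).
have N1 : 0 < N + 1 by lra.
have e'0 : 0 < e' by rewrite divr_gt0.
have mG : measurable_fun setT (fun t => e' * G t).
  apply: measurable_funM => //.
  rewrite (_ : bochner_val G = fun t => \sum_i `|F i t|); last exact/funext/GE.
  apply: measurable_sum => i.
  exact/strongly_measurable_norm/bochner_fun_strongly_measurable.
have mF i := bochner_fun_strongly_measurable (F i).
have [B [x [mB tB BT xB]]] := strongly_measurable_partition mF mG.
have close i t : `|F i t - step_fun B (x ^~ i) t| <= (e' *: G) t.
  have -> : (e' *: G) t = e' * G t by [].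
  have [[l Bt ->]|[nB ->]] := step_fun_case X tB t; first exact/ltW/xB.
  (* Off the cells the tolerance is not positive, so every [F i] vanishes there and 0 approximates
     it exactly. *)
  have Gt : G t <= 0.
    rewrite leNgt; apply/negP => Gt.
    have : (\bigcup_l B l) t by rewrite BT /=; exact: mulr_gt0.
    by move=> [l _]; exact: nB.
  have Fi : `|F i t| <= G t by rewrite GE (bigD1 i)//= lerDl sumr_ge0.
  have F0 : F i t = 0 by apply/eqP; rewrite -normr_le0; exact: le_trans Gt.
  rewrite F0 subrr normr0 mulr_ge0 ?(ltW e'0)//.
  by apply: le_trans Fi.
have mD i : strongly_measurable (fun t => F i t - step_fun B (x ^~ i) t).
  rewrite (_ : (fun t => _) = (-1) *: step_fun B (x ^~ i) + F i); last first.
    by apply/funext => t; rewrite addrC -scaleN1r.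
  apply: strongly_measurableZD => //; exact: step_fun_strongly_measurable.
have DP i := bochner_pred_le (mD i) (close i).
pose D i : bfun := BochnerFun (proj1 (DP i)).
(* Writing the step function as [F i - D i] makes it a member of [L_q], since the error [D i] is one
   by domination. *)
exists B, x, (fun i => F i - D i); split=> // [i t|i].
  change (F i t - (F i t - step_fun B (x ^~ i) t) = step_fun B (x ^~ i) t).
  by rewrite subKr.
have -> : bochner_class (F i - D i) - f i = - (bochner_class (D i) : bspace).
  rewrite -[f i]bochner_reprK -/(F i).
  have -> : bochner_class (F i - D i) =
      bochner_class (F i) - (bochner_class (D i) : bspace).
    exact: raddfB.
  by rewrite addrAC subrr add0r.
rewrite normrN -lee_fin bochner_space_normE; apply: le_trans (proj2 (DP i)) _.
rewrite -bochner_scaleE normrZ lee_fin gtr0_norm// -/N /e' mulrAC ler_pdivrMr//.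
by rewrite ler_pM2l//; lra.
Qed.

Hypothesis cop : copyable mu q.

(** The exact statement for step functions is transferred through an approximation of the spanning
    vectors by [e]; the weights sum to at most 1, so the averaged error stays below
    [e * abs_sum c]. *)
Lemma bochner_copies n m (lam : 'I_m -> R) (f : 'I_m -> 'I_n -> bspace) (e : R) :
  0 < e -> (forall i, 0 <= lam i) -> \sum_(i < m) lam i <= 1 ->
  exists v : 'I_n -> bspace, forall c,
    \sum_(i < m) lam i * `|lincomb (f i) c| <= `|lincomb v c| + e * abs_sum c /\
    forall M, 0 <= M -> (forall i, `|lincomb (f i) c| <= M) ->
      `|lincomb v c| <= M + e * abs_sum c.
Proof.
move=> e0 lam0 lam1.
have [B [x [u [mB tB uE uf]]]] :=
  bochner_step_approximation (fun ia : 'I_m * 'I_n => f ia.1 ia.2) e0.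
have [v vP] := step_copies cop (phi := fun i a l => x l (i, a))
  (u := fun i a => u (i, a)) mB tB (fun i a => uE (i, a)) lam0 lam1.
exists v => c; have [vl vu] := vP c.
have fu i : `|lincomb (f i) c| <=
    `|lincomb (classes (fun a => u (i, a))) c| + e * abs_sum c.
  by apply: lincomb_close => a; rewrite distrC; exact: (uf (i, a)).
have uf' i : `|lincomb (classes (fun a => u (i, a))) c| <=
    `|lincomb (f i) c| + e * abs_sum c.
  by apply: lincomb_close => a; exact: (uf (i, a)).
have ec0 : 0 <= e * abs_sum c by rewrite mulr_ge0 ?abs_sum_ge0 ?ltW.
split=> [|M M0 fM].
  apply: le_trans (_ : \sum_(i < m) lam i *
    (`|lincomb (classes (fun a => u (i, a))) c| + e * abs_sum c) <= _).
    by apply: ler_sum => i _; exact: ler_wpM2l.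
  under eq_bigr do rewrite mulrDr.
  by rewrite big_split/= -mulr_suml lerD// ler_piMl.
apply: vu => [|i]; first exact: addr_ge0.
by apply: le_trans (uf' i) _; rewrite lerD2r.
Qed.

End LqCopies.

(** * Finite sums of spaces *)

Section LpkBounds.
Context (R : realType) (k : nat) (p : \bar R) (p1 : (1 <= p)%E).
Variable E : 'I_k -> normedModType R.
Implicit Types a : Lpk_space E p1.
Let kap : R := k%:R `^ fine p^-1%E.

Lemma fine_inve_oo : fine (+oo^-1 : \bar R)%E = 0.
Proof. by []. Qed.

Hypothesis k_gt0 : (0 < k)%N.

(** The factor [kap] undoes the normalization by [1/k], leaving the ordinary [l_r] norm. *)
Lemma Lpk_scaled_normE a (r : R) : p = r%:E ->
  kap * `|a| = (\sum_(i < k) `|a i| `^ r) `^ r^-1.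
Proof.
move=> pr; have r0 : 0 < r by rewrite -lte_fin -pr (lt_le_trans lte01 p1).
rewrite Lpk_space_normE /kap /Lpk_norm pr inver gt_eqF//=.
rewrite -powRM ?ler0n//; last first.
  by rewrite mulr_ge0 ?invr_ge0// sumr_ge0// => i _; exact: powR_ge0.
by rewrite mulrA mulfV ?mul1r// pnatr_eq0 -lt0n.
Qed.

Lemma Lpk_coord_le a j : `|a j| <= kap * `|a|.
Proof.
case: (eqVneq p +oo%E) => [poo|pN].
  rewrite /kap Lpk_space_normE /Lpk_norm poo fine_inve_oo powRr0 mul1r.
  exact: (le_bigmax _ (fun i => `|a i|)).
have [r pr] : exists r, p = r%:E by case: p p1 pN => // r _ _; exists r.
have r0 : 0 < r by rewrite -lte_fin -pr (lt_le_trans lte01 p1).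
rewrite (Lpk_scaled_normE _ pr) -[leLHS](powRVK _ (lt0r_neq0 r0))//.
rewrite ge0_ler_powR ?nnegrE ?powR_ge0 ?invr_ge0 ?(ltW r0)//.
  by apply: sumr_ge0 => i _; exact: powR_ge0.
by rewrite (bigD1 j)//= lerDl sumr_ge0// => i _; exact: powR_ge0.
Qed.

(** This is the [l_r] norm against the [l_1] norm: with [S] the sum, [S^r] is the sum of the
    [|a i| S^(r-1)], and each [|a i|] is at most [S]. *)
Lemma Lpk_norm_le_sum a : kap * `|a| <= \sum_(j < k) `|a j|.
Proof.
have S0 : 0 <= \sum_(j < k) `|a j| by apply: sumr_ge0.
case: (eqVneq p +oo%E) => [poo|pN].
  rewrite /kap Lpk_space_normE /Lpk_norm poo fine_inve_oo powRr0 mul1r.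
  apply/bigmax_leP; split=> // i _.
  by rewrite (bigD1 i)//= lerDl sumr_ge0.
have [r pr] : exists r, p = r%:E by case: p p1 pN => // r _ _; exists r.
have r1 : 1 <= r by rewrite -lee_fin -pr.
have r0 : 0 < r by exact: lt_le_trans r1.
rewrite (Lpk_scaled_normE _ pr) -[leRHS](powRVK _ (lt0r_neq0 r0))//.
rewrite ge0_ler_powR ?nnegrE ?powR_ge0 ?invr_ge0 ?(ltW r0)//.
  by apply: sumr_ge0 => i _; exact: powR_ge0.
rewrite -[leRHS]powR_mul_pred ?gt_eqF// mulr_suml; apply: ler_sum => i _.
rewrite -[leLHS]powR_mul_pred ?gt_eqF// ler_wpM2l//.
rewrite ge0_ler_powR ?nnegrE ?subr_ge0//.
by rewrite (bigD1 i)//= lerDl sumr_ge0.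
Qed.

Lemma Lpk_norm_le a (M : R) : 0 <= M -> (forall j, `|a j| <= M) -> `|a| <= M.
Proof.
move=> M0 aM.
case: (eqVneq p +oo%E) => [poo|pN].
  by rewrite Lpk_space_normE /Lpk_norm poo; apply/bigmax_leP.
have [r pr] : exists r, p = r%:E by case: p p1 pN => // r _ _; exists r.
have r0 : 0 < r by rewrite -lte_fin -pr (lt_le_trans lte01 p1).
rewrite Lpk_space_normE /Lpk_norm pr -[leRHS](powRVK _ (lt0r_neq0 r0))//.
rewrite ge0_ler_powR ?nnegrE ?powR_ge0 ?invr_ge0 ?(ltW r0)//.
  by rewrite mulr_ge0 ?invr_ge0// sumr_ge0// => i _; exact: powR_ge0.
rewrite ler_pdivrMl ?ltr0n//.
apply: (@le_trans _ _ (\sum_(i < k) M `^ r)).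
  by apply: ler_sum => i _; rewrite ge0_ler_powR ?nnegrE ?(ltW r0).
by rewrite sumr_const card_ord mulr_natl.
Qed.

(** The power mean inequality with equal weights [1/k]. *)
Lemma Lpk_sum_le a : \sum_(j < k) `|a j| <= k%:R * `|a|.
Proof.
case: (eqVneq p +oo%E) => [poo|pN].
  rewrite Lpk_space_normE /Lpk_norm poo.
  apply: (@le_trans _ _ (\sum_(j < k) \big[Num.max/0]_(i < k) `|a i|)).
    by apply: ler_sum => j _; exact: (le_bigmax _ (fun i => `|a i|)).
  by rewrite sumr_const card_ord mulr_natl.
have [r pr] : exists r, p = r%:E by case: p p1 pN => // r _ _; exists r.
have r1 : 1 <= r by rewrite -lee_fin -pr.
have r0 : 0 < r by exact: lt_le_trans r1.
rewrite -ler_pdivrMl ?ltr0n// Lpk_space_normE /Lpk_norm pr.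
rewrite leNgt; apply/negP => /(gt0_ltr_powR r0).
rewrite !nnegrE powR_ge0 -powRrM mulVf ?gt_eqF// powRr1; last first.
  by rewrite mulr_ge0 ?invr_ge0// sumr_ge0// => i _; exact: powR_ge0.
move=> /(_ isT); rewrite mulr_ge0 ?invr_ge0 ?sumr_ge0// => /(_ isT).
rewrite ltNge !mulr_sumr powR_wmean_le//.
by rewrite sumr_const card_ord -[leLHS]mulr_natr mulVf// pnatr_eq0 -lt0n.
Qed.

End LpkBounds.

(** * From copies in the factors to the embedding *)

Section Assembly.
Context (R : realType).

(** The only property of the factors that the embedding relies on; it hides [q] and the measure. *)
Definition has_copies (Y : normedModType R) : Prop :=
  forall n m (lam : 'I_m -> R) (f : 'I_m -> 'I_n -> Y) (e : R),
    0 < e -> (forall i, 0 <= lam i) -> \sum_(i < m) lam i <= 1 ->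
  exists v : 'I_n -> Y, forall c,
    \sum_(i < m) lam i * `|lincomb (f i) c| <= `|lincomb v c| + e * abs_sum c /\
    forall M, 0 <= M -> (forall i, `|lincomb (f i) c| <= M) ->
      `|lincomb v c| <= M + e * abs_sum c.

Context (k : nat) (k_gt0 : (0 < k)%N) (p : \bar R) (p1 : (1 <= p)%E).
Variable E : 'I_k -> normedModType R.
Hypothesis copies : forall j, has_copies (E j).
Local Notation Y := (Lpk_space E p1).
Let kap : R := k%:R `^ fine p^-1%E.

Lemma Lpk_lincombE n (v : 'I_n -> Y) c j :
  lincomb v c j = lincomb (fun a => v a j) c.
Proof.
rewrite /lincomb; elim: (index_enum _) => [|a s IH]; first by rewrite !big_nil.
by rewrite !big_cons -IH.
Qed.

(** Copies are made in every coordinate separately, with the same weights. Passing between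
    coordinates and the whole tuple costs [kap] above and [kap / k] below. *)
Lemma Lpk_copies n m (lam : 'I_m -> R) (f : 'I_m -> 'I_n -> Y) (e : R) :
  0 < e -> (forall i, 0 <= lam i) -> \sum_(i < m) lam i <= 1 ->
  exists v : 'I_n -> Y, forall c,
    kap * \sum_(i < m) lam i * `|lincomb (f i) c| <=
      k%:R * (`|lincomb v c| + e * abs_sum c) /\
    forall M, 0 <= M -> (forall i, `|lincomb (f i) c| <= M) ->
      `|lincomb v c| <= kap * M + e * abs_sum c.
Proof.
move=> e0 lam0 lam1.
pose H j := cid (copies (fun i a => f i a j) e0 lam0 lam1).
pose v j := projT1 (H j); have vP j := projT2 (H j); rewrite -/(v _) in vP.
have kap0 : 0 <= kap by exact: powR_ge0.
exists (fun a => (fun j => v j a) : Y) => c.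
have vE j : lincomb (fun a => (fun j => v j a) : Y) c j = lincomb (v j) c.
  exact: Lpk_lincombE.
split=> [|M M0 fM]; last first.
  apply: Lpk_norm_le => [||j]; first exact: k_gt0.
    by rewrite addr_ge0 ?mulr_ge0 ?abs_sum_ge0// ltW.
  rewrite vE; apply: (proj2 (vP j c)) => [|i]; first exact: mulr_ge0.
  rewrite -Lpk_lincombE; apply: le_trans (Lpk_coord_le k_gt0 _ _) _.
  exact: ler_wpM2l.
rewrite mulrDr; apply: (@le_trans _ _
  (\sum_(j < k) (`|lincomb (v j) c| + e * abs_sum c))); last first.
  rewrite big_split/= [X in _ + X]sumr_const card_ord [X in _ <= _ + X]mulr_natl.
  apply: lerD => //; under eq_bigr do rewrite -vE.
  exact: Lpk_sum_le.
apply: (@le_trans _ _ (\sum_(j < k) \sum_(i < m) lam i * `|lincomb (f i) c j|)).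
  rewrite exchange_big/= mulr_sumr; apply: ler_sum => i _.
  by rewrite mulrCA -mulr_sumr ler_wpM2l//; exact: Lpk_norm_le_sum.
apply: ler_sum => j _; under eq_bigr do rewrite Lpk_lincombE.
exact: (proj1 (vP j c)).
Qed.

(** Sampling gives vectors of [Z], hence of the target space, whose weighted mean norm nearly
    dominates the [L_1] norm; the hypothesis on [W] bounds this below by the sup norm divided by
    [C]. Copying these vectors gives the embedding. *)
Lemma Lpk_LB_discretizes d (T : measurableType d) (mu : probability T R) :
  LB_discretizes mu Y (fun C => k%:R * C).
Proof.
move=> C Z C1 _ W Wfin WC.
have kap0 : 0 < kap by apply: powR_gt0; rewrite ltr0n.
have k0 : 0 < k%:R :> R by rewrite ltr0n.
have C0 : 0 < C by exact: lt_le_trans C1.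
have [n [b [bS bI]]] := finite_dim_basis Wfin.
have [K K0 bK] := independent_abs_sum_le bI.
pose f a := bochner_repr (val (b a)).
have mf a := bochner_fun_strongly_measurable (f a).
have mfc c := strongly_measurable_lincomb (f := fun a => f a : T -> _) mf c.
have wE c : val (lincomb b c) = bochner_class (lincomb f c).
  rewrite val_lincomb -bochner_class_lincomb; congr lincomb.
  by apply/funext => a; rewrite /= bochner_reprK.
have wN c : (bochner_norm mu +oo (fun t => lincomb (f ^~ t) c) = `|lincomb b c|%:E)%E.
  rewrite -(norm_class_lincomb f) subspace_normE wE.
  by rewrite bochner_class_lincomb.
have w1 c : (`|lincomb b c|%:E <= C%:E * \int[mu]_t `|lincomb (f ^~ t) c|%:E)%E.
  have := WC (val (lincomb b c)) (valP _).
  rewrite (@eq_bochner_norm _ _ _ _ _ _ _ (fun t => lincomb (f ^~ t) c))//.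
  - rewrite /bochner_norm Lnorm1.
    by under [X in (_ <= _ * X)%E]eq_integral do rewrite /= normr_id.
  - exact: bochner_fun_strongly_measurable.
  have : bochner_class (bochner_repr (val (lincomb b c))) = bochner_class (lincomb f c).
    by rewrite bochner_reprK wE.
  move/bochner_classP; apply: filterS => t ->; exact: bochner_lincombE.
(* The constant as upper bound over lower bound: the factor [kap] cancels. *)
have -> : k%:R * C = kap / (kap / (k%:R * C)).
  by field; rewrite !gt_eqF.
apply: (embeddable_lincomb bS bI).
- by rewrite divr_gt0// mulr_gt0.
- exact: ltW.
move=> eta eta0.
(* The errors add up to at most [e * (kap + 1) * (A + N)], and [A <= K * N] makes this at most
   [eta * N]. *)
pose e := eta / ((kap + 1) * (K + 1)).
have KK : 0 < (kap + 1) * (K + 1) by rewrite mulr_gt0//; lra.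
have e0 : 0 < e by rewrite divr_gt0.
have eE : e * ((kap + 1) * (K + 1)) = eta by rewrite /e divfK// gt_eqF.
have [m [lam [z [lam0 lam1 zP]]]] :=
  probability_discretization mu (f := fun a => f a : T -> _) mf e0.
have [v vP] := Lpk_copies (fun i a => val (z i a)) e0 lam0 lam1.
exists v => c.
set N := `|lincomb b c|; have N0 : 0 <= N by exact: normr_ge0.
set A := abs_sum c in vP *.
have A0 : 0 <= A by exact: abs_sum_ge0.
have AK : A <= K * N by exact: bK.
have [|zM zI] := zP c N.
  by apply/bochner_norm_oo_le => //; rewrite wN.
have [vl vu] := vP c.
have zE i : lincomb (fun a => val (z i a)) c = val (lincomb (z i) c).
  by rewrite val_lincomb.
apply/andP; split; last first.
  apply: le_trans (vu (N + e * A) _ _) _.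
  - by rewrite addr_ge0// mulr_ge0// ltW.
  - by move=> i; rewrite zE; exact: zM.
  rewrite -/A; have : e * (kap + 1) * A <= e * (kap + 1) * ((K + 1) * N).
    by apply: ler_wpM2l; [rewrite mulr_ge0 ?ltW//; lra|lra].
  by rewrite -eE; lra.
have {}zI : N <= C * (\sum_(l < m) lam l * `|lincomb (z l) c| + e * (A + N)).
  rewrite -lee_fin EFinM; apply: le_trans (w1 c) _.
  by rewrite lee_wpmul2l// lee_fin ltW.
move: vl; under eq_bigr do rewrite zE -subspace_normE.
set S := \sum_(l < m) _ in zI * => vl.
have eA : e * A + e * kap * (A + N) <= eta * N.
  have : e * (1 + kap) * (A + N) <= e * (1 + kap) * ((K + 1) * N).
    by apply: ler_wpM2l; [rewrite mulr_ge0 ?ltW//; lra|lra].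
  have : 0 <= e * N by rewrite mulr_ge0// ltW.
  by rewrite -eE; lra.
have k1 : 1 <= k%:R :> R by rewrite ler1n.
(* Since [k >= 1], the sampling error may be enlarged by [k] and merged with the copying error. *)
have ekk : kap * (e * (A + N)) <= k%:R * (e * kap * (A + N)).
  have h : 0 <= e * kap * (A + N).
    by rewrite mulr_ge0 ?addr_ge0// mulr_ge0 ?(ltW e0) ?(ltW kap0).
  by have := ler_wpM2r h k1; lra.
have kapN : kap * N <= C * (kap * S + kap * (e * (A + N))).
  by rewrite -mulrDr mulrCA ler_pM2l.
have {}kapN : kap * N <= C * (k%:R * (`|lincomb v c| + eta * N)).
  apply: le_trans kapN _; rewrite ler_pM2l//.
  have := ler_wpM2l (ltW k0) eA.
  move: vl ekk; rewrite -/A; lra.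
rewrite mulrBl lerBlDr mulrAC ler_pdivrMr ?mulr_gt0//.
by rewrite [leRHS]mulrC -mulrA [leRHS]mulrCA.
Qed.

End Assembly.

(** * The admissible factors and the comparison of [k] with [k^(2 - 1/p)] *)

Theorem proposition3p1 (R : realType) (k : nat) (k_gt0 : (0 < k)%N)
    (p : \bar R) (p1 : (1 <= p)%E)
    (q : 'I_k -> \bar R) (q1 : forall j, (1 <= q j)%E)
    (X : 'I_k -> completeNormedModType R)
    (Omega : 'I_k -> measure_space R)
    (hOmega : forall j,
      (nonatomic (ms_measure (Omega j)) /\
       separable_measure (ms_measure (Omega j))) \/
      Omega j = nat_counting_space R) :
  LB_discretization_property_le
    (Lpk_space (fun j => bochner_space (ms_measure (Omega j)) (q1 j) (X j)) p1)
    (fun C => k%:R `^ (2 - fine p^-1%E) * C).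
Proof.
move=> d T mu _.
have k1 : 1 <= k%:R :> R by rewrite ler1n.
(* The exponent [2 - 1/p] is at least 1 because [p >= 1], and the base [k] is at least 1. *)
have kk : k%:R <= k%:R `^ (2 - fine p^-1%E) :> R.
  rewrite -[leLHS]powRr1//; apply: ler_powR => //.
  suff : fine p^-1%E <= 1 :> R by lra.
  case: p p1 => [r r1|_|//]; last by rewrite fine_inve_oo.
  have r0 : 0 < r by rewrite -lte_fin (lt_le_trans lte01 r1).
  by rewrite inver gt_eqF//= invf_le1.
have copies j : has_copies (bochner_space (ms_measure (Omega j)) (q1 j) (X j)).
  move=> n m lam f e; apply: bochner_copies.
  case: (hOmega j) => [[na _]|->]; first exact: nonatomic_copyable.
  exact: counting_copyable.
exists (fun C => k%:R `^ (2 - fine p^-1%E) * C); split=> // C.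
  move=> C1; rewrite -[leLHS]mulr1; apply: ler_pM => //.
  exact: le_trans kk.
move=> Z C1 Zfin W Wfin WC; apply: embeddable_le; last first.
  exact: (Lpk_LB_discretizes k_gt0 copies C1 Zfin Wfin WC).
by rewrite ler_wpM2r// (le_trans ler01).
Qed.
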